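(* There are separable operator spaces $X$ and $Y$ such that (1) $X$ isomorphically embeds into $Y$ (as a Banach space); (2) $X$ does not almost completely isomorphically embed into $Y$; and (3) the bounded subsets of $X$ and $Y$ are almost completely coarsely equivalent.
   Context: An operator space is a Banach space $X$ with a fixed isometric embedding into some $B(H)$, $H$ a complex Hilbert space; $\mathrm{M}_n(X)$ ($n\times n$ matrices over $X$) carries the norm inherited from $\mathrm{M}_n(B(H))\cong B(H^{\oplus n})$. $B_X$ and $B_{\mathrm{M}_n(X)}$ denote closed unit balls. For $A\subset X$ and a map $f\colon A\to Y$ (not necessarily linear) between operator spaces, the $n$-th amplification is $f_n\colon \mathrm{M}_n(A)\to \mathrm{M}_n(Y)$, $f_n([x_{ij}])=[f(x_{ij})]$. A sequence $(g_n\colon X_n\to Y_n)_n$ of linear isomorphic embeddings between normed spaces is equi-isomorphic if $\sup_n\|g_n\|<\infty$ and $\sup_n\|g_n^{-1}\|<\infty$, where $g_n^{-1}$ is defined on the image of $g_n$. $X$ almost completely isomorphically embeds into $Y$ if there is a sequence $(f^n\colon X\to Y)_n$ of linear operators such that the amplifications $(f^n_n\colon \mathrm{M}_n(X)\to \mathrm{M}_n(Y))_n$ (the $n$-th amplification of the $n$-th map) are equi-isomorphic embeddings. A family of maps $(f_n\colon X_n\to Y_n)_n$ between metric spaces $(X_n,d_n)$ and $(Y_n,\partial_n)$ are equi-coarse embeddings if for all $r>0$ there is $s>0$ such that, for all $n$ and all $x,z\in X_n$: $d_n(x,z)\le r$ implies $\partial_n(f_n(x),f_n(z))\le s$, and $d_n(x,z)\ge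 s$ implies $\partial_n(f_n(x),f_n(z))\ge r$. The bounded subsets of $X$ and $Y$ are almost completely coarsely equivalent if there is a sequence of bijections $(f^n\colon X\to Y)_n$ such that, letting $g^n=(f^n)^{-1}$, both sequences $(f^n_n\restriction_{n\cdot B_{\mathrm{M}_n(X)}}\colon n\cdot B_{\mathrm{M}_n(X)}\to \mathrm{M}_n(Y))_n$ and $(g^n_n\restriction_{n\cdot B_{\mathrm{M}_n(Y)}}\colon n\cdot B_{\mathrm{M}_n(Y)}\to \mathrm{M}_n(X))_n$ are equi-coarse embeddings. *)

(* Defs.v *)
From HB Require Import structures.
From mathcomp Require Import all_boot all_order all_algebra.
From mathcomp Require Import sesquilinear complex.
From mathcomp Require Import all_classical all_reals all_analysis.

Set Implicit Arguments.
Unset Strict Implicit.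
Unset Printing Implicit Defensive.

Import Order.TTheory GRing.Theory Num.Theory.
Import numFieldNormedType.Exports.

Local Open Scope classical_set_scope.
Local Open Scope ring_scope.

Section Norms.
Context {R : realType}.

(* In a normed module over R[i] the norm `|x| is an element of R[i]
   (a nonnegative real one); vnorm x is that number as an element of R. *)
Definition vnorm {V : normedModType R[i]} (x : V) : R := complex.Re `|x|.

Definition opnorm (U V : Type) (nU : U -> R) (nV : V -> R) (g : U -> V) : \bar R :=
  ereal_sup [set (nV (g u))%:E | u in [set u | nU u <= 1]].

(* For g linear and injective, the norm of g^-1 : range g -> U, a point v = g u
   of the range being parametrised by u. *)
Definition inv_opnorm (U V : Type) (nU : U -> R) (nV : V -> R) (g : U -> V) :
  \bar R := ereal_sup [set (nU u)%:E | u in [set u | nV (g u) <= 1]].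

End Norms.

Record hilbertSpace (R : realType) := HilbertSpace {
  hilbert_sort :> completeNormedModType R[i];
  inner : {dot hilbert_sort for Num.conj};
  inner_norm : forall x : hilbert_sort, `|x| ^+ 2 = inner x x }.

(* os_emb x is the operator on os_hilbert by which x is represented.
   Bilinearity says that every os_emb x is linear and that x |-> os_emb x is
   linear; os_isometry says that every os_emb x is bounded and that
   x |-> os_emb x is an isometry into B(os_hilbert). *)
Record operatorSpace (R : realType) := OperatorSpace {
  os_sort :> completeNormedModType R[i];
  os_hilbert : hilbertSpace R;
  os_emb : {bilinear os_sort -> os_hilbert -> os_hilbert};
  os_isometry : forall x : os_sort, opnorm vnorm vnorm (os_emb x) = (vnorm x)%:E }.

Section MatrixNorm.
Context {R : realType}.

(* the norm of the Hilbert space direct sum of n copies of H *)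
Definition l2norm {V : normedModType R[i]} {n : nat} (xi : {ffun 'I_n -> V}) : R :=
  Num.sqrt (\sum_(i < n) vnorm (xi i) ^+ 2).

(* the operator on the direct sum of n copies of V given by a matrix of
   operators on V *)
Definition mxop {V : normedModType R[i]} {n : nat} (T : 'M[V -> V]_n)
    (xi : {ffun 'I_n -> V}) : {ffun 'I_n -> V} :=
  [ffun i => \sum_(j < n) T i j (xi j)].

(* The operator norm below is always finite: see mxnorm_fin_num. This is not
   the entrywise sup norm that the library puts on matrices. *)
Definition mxnorm {X : operatorSpace R} {n : nat} (x : 'M[X]_n) : R :=
  fine (opnorm l2norm l2norm (mxop (map_mx (os_emb X) x))).

Definition mxdist {X : operatorSpace R} {n : nat} (x z : 'M[X]_n) : R :=
  mxnorm (x - z).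

End MatrixNorm.

Section MatrixNormFacts.
Context {R : realType}.

Lemma vnormC (V : normedModType R[i]) (x : V) : `|x| = (vnorm x)%:C%C.
Proof. by rewrite /vnorm RRe_real // normr_real. Qed.

Lemma vnorm_ge0 (V : normedModType R[i]) (x : V) : 0 <= vnorm x.
Proof. by rewrite -lecR -vnormC normr_ge0. Qed.

Lemma vnorm0 (V : normedModType R[i]) : vnorm (0 : V) = 0.
Proof. by rewrite /vnorm normr0. Qed.

Lemma ler_vnorm_sum (V : normedModType R[i]) n (F : 'I_n -> V) :
  vnorm (\sum_(j < n) F j) <= \sum_(j < n) vnorm (F j).
Proof.
rewrite -lecR -vnormC rmorph_sum /=; apply: le_trans (ler_norm_sum _ _ _) _.
by apply: ler_sum => j _; rewrite vnormC.
Qed.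

Lemma os_emb_ball (X : operatorSpace R) (x : X) (h : os_hilbert X) :
  vnorm h <= 1 -> vnorm (os_emb X x h) <= vnorm x.
Proof.
move=> h1; rewrite -lee_fin -(os_isometry x).
by apply: ereal_sup_ubound; exists h.
Qed.

Lemma mxnorm_fin_num (X : operatorSpace R) n (x : 'M[X]_n) :
  opnorm l2norm l2norm (mxop (map_mx (os_emb X) x)) \is a fin_num.
Proof.
pose B := Num.sqrt (\sum_(i < n) (\sum_(j < n) vnorm (x i j)) ^+ 2).
rewrite fin_real //; apply/andP; split.
  apply: (@lt_le_trans _ _ 0%:E); first exact: ltNye.
  apply: (@le_trans _ _ (l2norm (mxop (map_mx (os_emb X) x) 0))%:E).
    by rewrite lee_fin sqrtr_ge0.
  apply: ereal_sup_ubound; exists 0 => //=.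
  rewrite /l2norm big1 ?sqrtr0 // => i _.
  by rewrite ffunE vnorm0 expr0n.
apply: (@le_lt_trans _ _ B%:E); last exact: ltey.
apply: ge_ereal_sup => _ [xi xi1 <-]; rewrite lee_fin ler_wsqrtr //.
apply: ler_sum => i _; rewrite ffunE lerXn2r ?nnegrE ?vnorm_ge0 //.
  by apply: sumr_ge0 => j _; exact: vnorm_ge0.
apply: le_trans (ler_vnorm_sum _) _; apply: ler_sum => j _; rewrite mxE.
apply: os_emb_ball; apply: le_trans xi1.
rewrite -[leLHS](ger0_norm (vnorm_ge0 _)) -sqrtr_sqr ler_wsqrtr //.
rewrite (bigD1 j) //= lerDl.
by apply: sumr_ge0 => k _; exact: sqr_ge0.
Qed.

End MatrixNormFacts.

Section Embeddings.
Context {R : realType}.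

(* Sequences are indexed by n >= 1; the value at n = 0 is irrelevant. *)

(* To be used with linear g n; the linearity is carried by the type of the maps
   in the definitions below. *)
Definition equi_isomorphic (U V : nat -> Type)
    (nU : forall n, U n -> R) (nV : forall n, V n -> R)
    (g : forall n, U n -> V n) : Prop :=
  [/\ forall n, (0 < n)%N -> injective (g n),
      (ereal_sup [set opnorm (nU n) (nV n) (g n) | n in [set n | (0 < n)%N]]
         < +oo)%E
    & (ereal_sup [set inv_opnorm (nU n) (nV n) (g n) | n in [set n | (0 < n)%N]]
         < +oo)%E].

Definition equi_coarse (U V : nat -> Type)
    (dU : forall n, U n -> U n -> R) (dV : forall n, V n -> V n -> R)
    (D : forall n, set (U n)) (f : forall n, U n -> V n) : Prop :=
  forall r : R, 0 < r -> exists2 s : R, 0 < s &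
    forall n, (0 < n)%N -> forall x z, D n x -> D n z ->
      (dU n x z <= r -> dV n (f n x) (f n z) <= s) /\
      (s <= dU n x z -> r <= dV n (f n x) (f n z)).

Definition separable (T : topologicalType) : Prop :=
  exists2 A : set T, countable A & dense A.

Definition isomorphically_embeds (X Y : normedModType R[i]) : Prop :=
  exists f : {linear X -> Y},
    [/\ injective f, (opnorm vnorm vnorm f < +oo)%E
      & (inv_opnorm vnorm vnorm f < +oo)%E].

Definition almost_completely_isomorphically_embeds (X Y : operatorSpace R) : Prop :=
  exists f : nat -> {linear X -> Y},
    @equi_isomorphic (fun n => 'M[X]_n) (fun n => 'M[Y]_n)
      (fun n => mxnorm) (fun n => mxnorm) (fun n => map_mx (f n)).

(* the ball n . B_{M_n(X)} *)
Definition mxball (X : operatorSpace R) (n : nat) : set 'M[X]_n :=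
  [set x | mxnorm x <= n%:R].

Definition bounded_subsets_almost_completely_coarsely_equivalent
    (X Y : operatorSpace R) : Prop :=
  exists (f : nat -> X -> Y) (g : nat -> Y -> X),
    [/\ forall n, (0 < n)%N -> cancel (f n) (g n) /\ cancel (g n) (f n),
        @equi_coarse (fun n => 'M[X]_n) (fun n => 'M[Y]_n)
          (fun n => mxdist) (fun n => mxdist) (@mxball X) (fun n => map_mx (f n))
      & @equi_coarse (fun n => 'M[Y]_n) (fun n => 'M[X]_n)
          (fun n => mxdist) (fun n => mxdist) (@mxball Y) (fun n => map_mx (g n))].

End Embeddings.

(* Main.v *)
(* Let A be the space of paths s = (s_m) of bounded variation in l2 with s_m
   supported on the first m coordinates (an l1-sum of the spaces l2^m), and map a path
   to its limit; this is a quotient map of A onto l2.  For e >= 0 put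
   A_e = {(s, y) : s -> e y}, normed by var(s) + |y|, with operator space structure the
   maximum of the minimal structure and of the column structure of y.  The map
   (s, y) |-> (s + (e' - e) phi(y), y), phi a bounded nonlinear lifting of y to a path,
   is a bijection A_e -> A_e'; on n x n matrices in the ball of radius n it moves
   distances by O(n^3 |e' - e|), hence by at most 1 if e' - e is small.  With
   e_k = 1/(k+1) take Y = c0(A_{e_k}) + E and X = A_0 + Y, where E is the c0-sum of copies
   of l2 + A with the minimal structure.  For each n, X and Y are matched by sliding A_0 into
   the place of A_{e_K}, A_{e_K} into that of A_{e_(K+1)}, and so on, K = 4 n^3.
   As a Banach space X embeds into Y by sending A_0 into E.  But a bounded linear v from
   the column space in A_0 to Y sends the unit vectors, by the Schur property of A, to
   vectors whose y-parts tend to 0 in every A_{e_k}, since e_k > 0; so along a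
   subsequence these y-parts live in essentially disjoint cells, and v is bounded on
   columns of n of these unit vectors, whereas these columns have norm sqrt n in X. *)
From HB Require Import structures.
Require Import Defs.
From mathcomp Require Import all_boot all_order all_algebra.
From mathcomp Require Import finmap sesquilinear complex.
From mathcomp Require Import all_classical all_reals all_analysis.
From mathcomp Require Import zify ring lra.

Set Implicit Arguments.
Unset Strict Implicit.
Unset Printing Implicit Defensive.

Import Order.TTheory GRing.Theory Num.Theory.
Import numFieldNormedType.Exports.
Import ComplexField.Normc.

Local Open Scope classical_set_scope.
Local Open Scope ring_scope.

(** * Finite l2 sums *)

(** The separation of X from Y rests on the quotient of A onto l2, which has bounded liftings but,
    by the Schur property of A, no bounded linear one. At weight 0 the constraint on (s, y)
    decouples and the column l2 is a linear summand; at a positive weight y is determined by s, so a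
    linear map out of l2 cannot keep the y-parts of the images of unit vectors large. A nonlinear
    bijection changes weight e into weight 0 on a bounded set at a cost proportional to e. As the
    maps may vary with n, it is enough that the weights of Y come arbitrarily close to 0 without
    reaching it. The price is that the bound of |y| by the variation divided by e_k degenerates as k
    grows, so the Schur argument is uniform only over finitely many cells. The c0 condition controls
    the remaining cells, for finitely many vectors; alternating the two makes the y-parts
    essentially disjoint. The columns do not enlarge the norm of a single vector, so as a Banach
    space A_0 fits into a cell without constraint; as E has infinitely many of these, room for one
    more is made by a shift. *)

Section FiniteL2.
Context {R : realType}.
Implicit Types z w : R[i].

Lemma normcE_norm z : `|z| = (normc z)%:C%C.
Proof. by []. Qed.

Lemma normc_ge0 z : 0 <= normc z.
Proof. by case: z => a b; exact: sqrtr_ge0. Qed.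

Lemma normc_real (a : R) : normc a%:C%C = `|a|.
Proof. by rewrite /normc /= expr0n addr0 sqrtr_sqr. Qed.

Lemma le_normc_sum (I : Type) (r : seq I) (a : I -> R[i]) :
  normc (\sum_(i <- r) a i) <= \sum_(i <- r) normc (a i).
Proof.
elim: r => [|i r IH]; first by rewrite !big_nil normc0.
by rewrite !big_cons; apply: le_trans (le_normcD _ _) _; rewrite lerD2l.
Qed.

Lemma normc_le_add (u v : R) : normc (u +i* v)%C <= `|u| + `|v|.
Proof.
rewrite -[leRHS]ger0_norm ?addr_ge0 // -sqrtr_sqr /= ler_wsqrtr //.
rewrite sqrrD !real_normK ?num_real // lerD2r lerDl mulrn_wge0 //.
Qed.

Lemma cauchy_schwarz2 (u v p q : R) : 0 <= u -> 0 <= v -> 0 <= p -> 0 <= q ->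
  u * v + p * q <= normc (u +i* p)%C * normc (v +i* q)%C.
Proof.
move=> u0 v0 p0 q0; rewrite -[leLHS]ger0_norm ?addr_ge0 ?mulr_ge0 //.
rewrite /= -sqrtrM ?addr_ge0 ?sqr_ge0 // -sqrtr_sqr ler_wsqrtr // -subr_ge0.
suff -> : (u ^+ 2 + p ^+ 2) * (v ^+ 2 + q ^+ 2) - (u * v + p * q) ^+ 2 =
  (u * q - p * v) ^+ 2 by exact: sqr_ge0.
by ring.
Qed.

Definition l2s (I : Type) (r : seq I) (a : I -> R[i]) : R :=
  Num.sqrt (\sum_(i <- r) normc (a i) ^+ 2).

Section l2s.
Context {I : Type}.
Implicit Types (r : seq I) (a b : I -> R[i]).

Lemma l2s_ge0 r a : 0 <= l2s r a.
Proof. exact: sqrtr_ge0. Qed.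

Lemma sum_normc2_ge0 r a : 0 <= \sum_(i <- r) normc (a i) ^+ 2.
Proof. by apply: sumr_ge0 => i _; apply: sqr_ge0. Qed.

Lemma l2s_sqr r a : l2s r a ^+ 2 = \sum_(i <- r) normc (a i) ^+ 2.
Proof. by rewrite sqr_sqrtr // sum_normc2_ge0. Qed.

Lemma l2s_le r a (B : R) : 0 <= B ->
  (l2s r a <= B) = (\sum_(i <- r) normc (a i) ^+ 2 <= B ^+ 2).
Proof.
by move=> B0; rewrite -l2s_sqr ler_pXn2r // ?nnegrE ?l2s_ge0.
Qed.

Lemma l2s_nil a : l2s [::] a = 0.
Proof. by rewrite /l2s big_nil sqrtr0. Qed.

(** The modulus of a complex number serves as the Euclidean norm of a real pair: unrolled in this
    way, the triangle inequality and Cauchy-Schwarz for l2 sums follow by induction from the planar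
    case. *)
Lemma l2s_cons i r a : l2s (i :: r) a = normc (normc (a i) +i* l2s r a)%C.
Proof. by rewrite /= l2s_sqr /l2s big_cons. Qed.

Lemma l2s_cat r s a : l2s (r ++ s) a = normc (l2s r a +i* l2s s a)%C.
Proof. by rewrite /= !l2s_sqr /l2s big_cat. Qed.

Lemma normc_homo (u v u' v' : R) : 0 <= u <= u' -> 0 <= v <= v' ->
  normc (u +i* v)%C <= normc (u' +i* v')%C.
Proof.
move=> /andP[u0 uu] /andP[v0 vv] /=; rewrite ler_wsqrtr // lerD //.
  by rewrite lerXn2r // nnegrE // (le_trans u0).
by rewrite lerXn2r // nnegrE // (le_trans v0).
Qed.

Lemma ler_l2s r a b : (forall i, normc (a i) <= normc (b i)) ->
  l2s r a <= l2s r b.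
Proof.
move=> ab; rewrite ler_wsqrtr // ler_sum // => i _.
by rewrite lerXn2r // nnegrE normc_ge0.
Qed.

Lemma l2sD r a b : l2s r (a + b) <= l2s r a + l2s r b.
Proof.
elim: r => [|i r IH]; first by rewrite !l2s_nil addr0.
rewrite !l2s_cons; apply: le_trans (le_normcD _ _) => /=.
by apply: (@normc_homo _ _ (_ + _) (_ + _)); rewrite ?normc_ge0 ?l2s_ge0 ?le_normcD.
Qed.

Lemma l2sZ r c a : l2s r (c *: a) = normc c * l2s r a.
Proof.
rewrite /l2s -[normc c]ger0_norm ?normc_ge0 // -sqrtr_sqr -sqrtrM ?sqr_ge0 //.
by congr Num.sqrt; rewrite mulr_sumr; apply: eq_bigr => i _; rewrite normcM exprMn.
Qed.

Lemma l2sN r a : l2s r (- a) = l2s r a.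
Proof. by rewrite /l2s; congr Num.sqrt; apply: eq_bigr => i _; rewrite normcN. Qed.

Lemma l2sB r a b : l2s r (a - b) <= l2s r a + l2s r b.
Proof. by rewrite -(l2sN r b); apply: l2sD. Qed.

Lemma l2s0 r : l2s r 0 = 0.
Proof. by rewrite -(scale0r 0) l2sZ normc0 mul0r. Qed.

Lemma l2s_sum r (J : Type) (s : seq J) (a : J -> I -> R[i]) :
  l2s r (\sum_(j <- s) a j) <= \sum_(j <- s) l2s r (a j).
Proof.
elim: s => [|j s IH]; first by rewrite !big_nil l2s0.
by rewrite !big_cons; apply: le_trans (l2sD _ _ _) _; rewrite lerD2l.
Qed.

Lemma l2s_le_sum r a : l2s r a <= \sum_(i <- r) normc (a i).
Proof.
elim: r => [|i r IH]; first by rewrite l2s_nil big_nil.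
rewrite l2s_cons big_cons; apply: le_trans (normc_le_add _ _) _.
by rewrite !ger0_norm ?normc_ge0 ?l2s_ge0 // lerD2l.
Qed.

Lemma cauchy_schwarz r a b :
  normc (\sum_(i <- r) a i * b i) <= l2s r a * l2s r b.
Proof.
apply: le_trans (le_normc_sum _ _) _.
elim: r => [|i r IH]; first by rewrite big_nil l2s_nil mul0r.
rewrite big_cons normcM !l2s_cons.
apply: le_trans (_ : normc (a i) * normc (b i) + l2s r a * l2s r b <= _).
  by rewrite lerD2l.
by apply: cauchy_schwarz2; rewrite ?normc_ge0 ?l2s_ge0.
Qed.

End l2s.

Lemma normc_le_l2s (I : eqType) (r : seq I) (a : I -> R[i]) i : i \in r ->
  normc (a i) <= l2s r a.
Proof.
move=> ir; rewrite -[leLHS]ger0_norm ?normc_ge0 // -sqrtr_sqr ler_wsqrtr //.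
rewrite (big_rem _ ir) /= lerDl; exact: sum_normc2_ge0.
Qed.

Lemma eq_l2s (I : eqType) (r : seq I) (a b : I -> R[i]) :
  {in r, a =1 b} -> l2s r a = l2s r b.
Proof.
move=> ab; rewrite /l2s; congr Num.sqrt; rewrite !big_seq.
by apply: eq_bigr => i ir; rewrite ab.
Qed.

Lemma l2s_map (I J : Type) (g : I -> J) (r : seq I) (a : J -> R[i]) :
  l2s (map g r) a = l2s r (a \o g).
Proof. by rewrite /l2s big_map. Qed.

Lemma ler_sum_subset (I : eqType) (r s : seq I) (f : I -> R) :
  (forall i, 0 <= f i) -> uniq r -> {subset r <= s} ->
  \sum_(i <- r) f i <= \sum_(i <- s) f i.
Proof.
move=> f0; elim: r s => [|i r IH] s /=; first by rewrite big_nil sumr_ge0.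
move=> /andP[ir ur] rs; have iS : i \in s by apply: rs; rewrite mem_head.
rewrite big_cons (big_rem _ iS) /= lerD2l IH // => j jr.
have : j \in i :: rem i s by rewrite -(perm_mem (perm_to_rem iS)) rs // inE jr orbT.
by rewrite inE => /orP[/eqP ji|//]; move: ir; rewrite -ji jr.
Qed.

Lemma l2s_subset (I : eqType) (r s : seq I) (a : I -> R[i]) :
  uniq r -> {subset r <= s} -> l2s r a <= l2s s a.
Proof.
by move=> ur rs; rewrite ler_wsqrtr // ler_sum_subset // => i; exact: sqr_ge0.
Qed.

Lemma l2s_single (I : eqType) (r : seq I) (j : I) (c : R[i]) : uniq r ->
  l2s r (fun i => if i == j then c else 0) <= normc c.
Proof.
move=> ur; rewrite l2s_le ?normc_ge0 //.
have [jr|jr] := boolP (j \in r); last first.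
  rewrite big_seq big1 ?sqr_ge0 // => i ir.
  by case: eqP => [ij|_]; [rewrite -ij ir in jr|rewrite normc0 expr0n].
rewrite (bigD1_seq j) //= eqxx big1 ?addr0 // => i /negbTE ->.
by rewrite normc0 expr0n.
Qed.

End FiniteL2.

(** * Banach spaces of families defined by seminorms *)

(** One construction serves both l2(J) and the path spaces: the norm is the supremum of the [sn d].
    By [sn_coord] a Cauchy filter converges in each coordinate, by [sn_finite] each seminorm is
    continuous for this pointwise convergence, and [sn_closed] keeps the limit inside. *)
Record seminormFamily (R : realType) := SeminormFamily {
  sn_index : Type;
  sn_dir : Type;
  sn_dir0 : sn_dir;
  sn : sn_dir -> (sn_index -> R[i]) -> R;
  sn_mem : set (sn_index -> R[i]);
  snD : forall d x y, sn d (x + y) <= sn d x + sn d y;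
  snZ : forall d c x, sn d (c *: x) = normc c * sn d x;
  sn_finite : forall d, exists s : seq sn_index,
    forall x, sn d x <= \sum_(i <- s) normc (x i);
  sn_coord : forall i, exists d, forall x, normc (x i) <= sn d x;
  sn_mem0 : sn_mem 0;
  sn_memD : forall x y, sn_mem x -> sn_mem y -> sn_mem (x + y);
  sn_memZ : forall c x, sn_mem x -> sn_mem (c *: x);
  sn_bounded : forall x, sn_mem x -> exists B, forall d, sn d x <= B;
  sn_closed : forall x, (forall eps, 0 < eps ->
      exists2 z, sn_mem z & forall d, sn d (x - z) <= eps) -> sn_mem x }.

Section BanachSpace.
Context {R : realType} (D : seminormFamily R).

Definition sn_pred : pred (sn_index D -> R[i]) := fun x => `[<sn_mem x>].

Lemma sn_predP x : reflect (sn_mem x) (x \in sn_pred).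
Proof. exact: asboolP. Qed.

Lemma sn_submod_closed : submod_closed sn_pred.
Proof.
split; first by apply/sn_predP; exact: sn_mem0.
by move=> c x y /sn_predP xP /sn_predP yP; apply/sn_predP/sn_memD => //; exact: sn_memZ.
Qed.

HB.instance Definition _ := GRing.isSubmodClosed.Build R[i] _ sn_pred sn_submod_closed.

Definition sn_space := {x : sn_index D -> R[i] | x \in sn_pred}.

HB.instance Definition _ := SubChoice.on sn_space.
HB.instance Definition _ := [SubChoice_isSubLmodule of sn_space by <:].

Definition sn_mk (x : sn_index D -> R[i]) (xP : sn_mem x) : sn_space :=
  exist _ x (introT (sn_predP x) xP).

Definition sn_norm (x : sn_space) : R := sup [set sn d (val x) | d in setT].

Lemma sn_memP (u : sn_space) : sn_mem (val u).
Proof. exact/sn_predP/valP. Qed.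

Implicit Types (d : sn_dir D) (x y : sn_index D -> R[i]).

Lemma sn0 d : sn d (0 : sn_index D -> R[i]) = 0.
Proof. by rewrite -(scale0r 0) snZ normc0 mul0r. Qed.

Lemma snN d x : sn d (- x) = sn d x.
Proof. by rewrite -scaleN1r snZ normcN normc1 mul1r. Qed.

Lemma snB d x y : sn d (x - y) <= sn d x + sn d y.
Proof. by rewrite -(snN d y); exact: snD. Qed.

Lemma sn_ge0 d x : 0 <= sn d x.
Proof.
have := snB d x x; rewrite subrr sn0.
by rewrite -mulr2n pmulrn_lge0.
Qed.

Lemma sn_has_sup (u : sn_space) : has_sup [set sn d (val u) | d in setT].
Proof.
split; first by exists (sn (sn_dir0 D) (val u)); exists (sn_dir0 D).
by have [B uB] := sn_bounded (elimT (sn_predP _) (valP u)); exists B => _ [d _ <-].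
Qed.

Lemma sn_le_norm (u : sn_space) d : sn d (val u) <= sn_norm u.
Proof. by apply: ub_le_sup; [case: (sn_has_sup u)|exists d]. Qed.

Lemma sn_norm_le (u : sn_space) (B : R) :
  (forall d, sn d (val u) <= B) -> sn_norm u <= B.
Proof.
by move=> uB; apply: ge_sup; [case: (sn_has_sup u)|move=> _ [d _ <-]].
Qed.

Lemma sn_norm_ge0 (u : sn_space) : 0 <= sn_norm u.
Proof. exact: le_trans (sn_ge0 (sn_dir0 D) _) (sn_le_norm _ _). Qed.

Lemma normc_sn_norm (u : sn_space) i : normc (val u i) <= sn_norm u.
Proof. by have [d ud] := sn_coord i; apply: le_trans (ud _) (sn_le_norm u d). Qed.

Lemma sn_normD (u v : sn_space) :
  (sn_norm (u + v))%:C%C <= (sn_norm u)%:C%C + (sn_norm v)%:C%C.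
Proof.
rewrite -rmorphD lecR; apply: sn_norm_le => d; rewrite raddfD.
by apply: le_trans (snD _ _ _) _; rewrite lerD ?sn_le_norm.
Qed.

Lemma sn_normZ c (u : sn_space) :
  (sn_norm (c *: u))%:C%C = `|c| * (sn_norm u)%:C%C.
Proof.
rewrite normcE_norm -rmorphM; congr (_%:C)%C; apply/eqP; rewrite eq_le.
apply/andP; split.
  apply: sn_norm_le => d; rewrite linearZ /= snZ.
  by rewrite ler_wpM2l ?normc_ge0 ?sn_le_norm.
have [->|c0] := eqVneq c 0; first by rewrite normc0 mul0r sn_norm_ge0.
have nc0 : 0 < normc c.
  by rewrite lt_def normc_ge0 andbT; apply: contra c0 => /eqP/eq0_normc ->.
rewrite -ler_pdivlMl //; apply: sn_norm_le => d.
by rewrite ler_pdivlMl // -snZ; exact: (sn_le_norm (c *: u)).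
Qed.

Lemma sn_norm0_eq0 (u : sn_space) : (sn_norm u)%:C%C = 0 -> u = 0.
Proof.
move=> [u0]; apply/val_inj/funext => i; rewrite raddf0.
by apply: eq0_normc; apply/eqP; rewrite eq_le normc_ge0 andbT -u0 normc_sn_norm.
Qed.

HB.instance Definition _ := Lmodule_isNormed.Build R[i] sn_space
  sn_normD sn_normZ sn_norm0_eq0.

Lemma vnorm_sn (u : sn_space) : vnorm u = sn_norm u.
Proof. by []. Qed.

Lemma normr_sn (u : sn_space) : `|u| = (sn_norm u)%:C%C.
Proof. by []. Qed.

Lemma sn_cauchy_ball (F : set_system sn_space) (FF : ProperFilter F) :
  cauchy F -> forall eps : R, 0 < eps ->
  exists u, F [set v | sn_norm (u - v) < eps].
Proof.
move=> /cauchyP Fc eps e0; have [|u Fu] := Fc eps%:C%C; first by rewrite ltcR.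
exists u.
by apply: filterS Fu => v; rewrite -ball_normE /= normr_sn ltcR.
Qed.

Lemma sn_coord_cvg (F : set_system sn_space) (FF : ProperFilter F) i
    (p : R[i] -> R) :
  (forall z w, p (z - w) = p z - p w) -> (forall z, `|p z| <= normc z) ->
  cauchy F -> cvg ((fun u : sn_space => p (val u i)) @ F).
Proof.
move=> pB pn Fc; apply: cauchy_cvg; apply/cauchyP => eps e0.
have [u Fu] := sn_cauchy_ball FF Fc e0.
exists (p (val u i)); rewrite nbhs_simpl /=.
apply: filterS Fu => v; rewrite /ball /= -pB; apply: le_lt_trans.
apply: le_trans (pn _) _; exact: (normc_sn_norm (u - v) i).
Qed.

Lemma normc_Re (z : R[i]) : `|complex.Re z| <= normc z.
Proof.
case: z => a b /=; rewrite -[leLHS]sqrtr_sqr.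
by rewrite ler_wsqrtr // lerDl sqr_ge0.
Qed.

Lemma normc_Im (z : R[i]) : `|complex.Im z| <= normc z.
Proof.
case: z => a b /=; rewrite -[leLHS]sqrtr_sqr.
by rewrite ler_wsqrtr // lerDr sqr_ge0.
Qed.

Lemma normc_le_ReIm (z : R[i]) : normc z <= `|complex.Re z| + `|complex.Im z|.
Proof. by case: z => a b; exact: normc_le_add. Qed.

Lemma sn_complete (F : set_system sn_space) : ProperFilter F -> cauchy F -> cvg F.
Proof.
move=> FF Fc.
have Rc i : cvg ((fun u : sn_space => complex.Re (val u i)) @ F).
  by apply: (sn_coord_cvg FF) => //; [move=> [a b] [c d]|exact: normc_Re].
have Ic i : cvg ((fun u : sn_space => complex.Im (val u i)) @ F).
  by apply: (sn_coord_cvg FF) => //; [move=> [a b] [c d]|exact: normc_Im].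
pose x i := (lim ((fun u : sn_space => complex.Re (val u i)) @ F) +i*
  lim ((fun u : sn_space => complex.Im (val u i)) @ F))%C.
have xcoord i (eps : R) : 0 < eps -> F [set v | normc (x i - val v i) <= eps].
  move=> e0; have e2 : 0 < eps / 2 by rewrite divr_gt0.
  have /cvgrPdist_le/(_ _ e2) FR := Rc i.
  have /cvgrPdist_le/(_ _ e2) FI := Ic i.
  apply: filterS2 FR FI => v ra ib /=.
  apply: le_trans (normc_le_ReIm _) _.
  by rewrite (splitr eps) !raddfB lerD.
have xsum (s : seq (sn_index D)) (eps : R) : 0 < eps ->
    F [set v : sn_space | \sum_(i <- s) normc ((x - val v) i) <= eps].
  elim: s eps => [|i s IH] eps e0.
    by apply: filterS (filterT) => v _ /=; rewrite big_nil ltW.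
  have e2 : 0 < eps / 2 by rewrite divr_gt0.
  apply: filterS2 (xcoord i _ e2) (IH _ e2) => v /= iv sv.
  by rewrite big_cons (splitr eps) lerD.
have near_x (eps : R) : 0 < eps -> F [set v : sn_space | forall d, sn d (x - val v) <= eps].
  move=> e0; have e2 : 0 < eps / 2 by rewrite divr_gt0.
  have e4 : 0 < eps / 2 / 2 by rewrite divr_gt0.
  have [u Fu] := sn_cauchy_ball FF Fc e4.
  (* The auxiliary point [v] is taken close to [x] on the finitely many coordinates that dominate
     [sn d]. It depends on [d], but the resulting bound does not. *)
  have xu d : sn d (x - val u) <= eps / 2.
    have [s sd] := sn_finite d.
    have [v [/= v1 v2]] := filter_ex (filterI Fu (xsum s _ e4)).
    have -> : x - val u = (x - val v) + (val v - val u) by rewrite addrA subrK.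
    apply: le_trans (snD _ _ _) _; rewrite (splitr (eps / 2)) lerD //.
      exact: le_trans (sd _) v2.
    rewrite -(snN d) opprB; apply: le_trans (ltW v1).
    exact: (sn_le_norm (u - v) d).
  apply: filterS Fu => v /= uv d.
  have -> : x - val v = (x - val u) + (val u - val v) by rewrite addrA subrK.
  apply: le_trans (snD _ _ _) _; rewrite (splitr eps) lerD //.
  apply: le_trans (sn_le_norm (u - v) d) _.
  by apply: le_trans (ltW uv) _; lra.
have xP : sn_mem x.
  apply: sn_closed => eps e0; have [v vP] := filter_ex (near_x _ e0).
  by exists (val v) => //; exact/sn_predP/valP.
apply/cvg_ex; exists (sn_mk xP); apply/cvgrPdist_le => eps e0.
have /complex_realP [r er] : eps \is Num.real by rewrite ger0_real // ltW.
move: e0; rewrite er ltcR => r0.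
apply: filterS (near_x _ r0) => v /= vx; rewrite normr_sn lecR.
exact: sn_norm_le.
Qed.

HB.instance Definition _ := Uniform_isComplete.Build sn_space sn_complete.

End BanachSpace.

(** * The Hilbert space l2(J) *)

Section HilbertSpace.
Context {R : realType} (J : choiceType).

Definition ell2_mem : set (J -> R[i]) :=
  [set x | exists B, forall F : {fset J}, l2s F x <= B].

Lemma ell2_finite (F : {fset J}) : exists s : seq J,
  forall x : J -> R[i], l2s F x <= \sum_(i <- s) normc (x i).
Proof. by exists F => x; exact: l2s_le_sum. Qed.

Lemma ell2_coord (i : J) : exists F : {fset J},
  forall x : J -> R[i], normc (x i) <= l2s F x.
Proof. by exists [fset i]%fset => x; apply: normc_le_l2s; rewrite inE. Qed.

Lemma ell2_mem0 : ell2_mem 0.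
Proof. by exists 0 => F; rewrite l2s0. Qed.

Lemma ell2_memD x y : ell2_mem x -> ell2_mem y -> ell2_mem (x + y).
Proof.
move=> [B xB] [C yC]; exists (B + C) => F.
by apply: le_trans (l2sD _ _ _) _; rewrite lerD.
Qed.

Lemma ell2_memZ c x : ell2_mem x -> ell2_mem (c *: x).
Proof.
move=> [B xB]; exists (normc c * B) => F.
by rewrite l2sZ ler_wpM2l ?normc_ge0.
Qed.

Lemma ell2_closed (x : J -> R[i]) : (forall eps, 0 < eps ->
  exists2 z, ell2_mem z & forall F : {fset J}, l2s F (x - z) <= eps) -> ell2_mem x.
Proof.
move=> /(_ 1 ltr01) [z [B zB] xz]; exists (B + 1) => F.
by rewrite -[x](subrKC z); apply: le_trans (l2sD _ _ _) _; rewrite lerD.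
Qed.

Definition ell2_family : seminormFamily R :=
  SeminormFamily fset0 (sn := fun F : {fset J} => @l2s R J F) (fun F : {fset J} => @l2sD _ _ F) (fun F => @l2sZ _ _ F)
    ell2_finite ell2_coord ell2_mem0 ell2_memD ell2_memZ (fun x h => h) ell2_closed.

Definition ell2 := sn_space ell2_family.

(** Limits along the directed set of finite subsets of [J], since [J] need not be countable: for the
    path spaces it is built from an uncountable set of tags. *)
Definition net_lim (u : {fset J} -> R[i]) (c : R[i]) : Prop :=
  forall eps, 0 < eps -> exists F0 : {fset J},
    forall F : {fset J}, (F0 `<=` F)%fset -> normc (c - u F) <= eps.

Lemma net_limD u v c d : net_lim u c -> net_lim v d -> net_lim (u + v) (c + d).
Proof.
move=> uc vd eps e0; have e2 : 0 < eps / 2 by rewrite divr_gt0.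
have [F1 h1] := uc _ e2; have [F2 h2] := vd _ e2.
exists (F1 `|` F2)%fset => F; rewrite fsubUset => /andP[/h1 k1 /h2 k2].
rewrite opprD addrACA (splitr eps).
by apply: le_trans (le_normcD _ _) _; rewrite lerD.
Qed.

Lemma net_limZ a u c : net_lim u c -> net_lim (a *: u) (a * c).
Proof.
move=> uc eps e0; have a1 : 0 < normc a + 1 by rewrite ltr_wpDl ?normc_ge0.
have [|F0 h] := uc (eps / (normc a + 1)); first by rewrite divr_gt0.
exists F0 => F /h k; rewrite -mulrBr normcM.
apply: le_trans (_ : (normc a + 1) * normc (c - u F) <= _).
  by rewrite ler_wpM2r ?normc_ge0 // lerDl.
by rewrite mulrC -ler_pdivlMr.
Qed.

Lemma net_limN u c : net_lim u c -> net_lim (- u) (- c).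
Proof. by move=> uc; rewrite -[- u]scaleN1r -[- c]mulN1r; exact: net_limZ. Qed.

Lemma net_lim_unique u c d : net_lim u c -> net_lim u d -> c = d.
Proof.
move=> uc ud; apply/subr0_eq/eq0_normc/eqP; rewrite eq_le normc_ge0 andbT.
apply/ler_addgt0Pl => eps e0; rewrite addr0; have e2 : 0 < eps / 2 by rewrite divr_gt0.
have [F1 h1] := uc _ e2; have [F2 h2] := ud _ e2.
have -> : c - d = (c - u (F1 `|` F2)%fset) - (d - u (F1 `|` F2)%fset).
  by rewrite opprB addrA subrK.
apply: le_trans (le_normcD _ _) _; rewrite normcN (splitr eps) lerD //.
  by apply: h1; exact: fsubsetUl.
by apply: h2; exact: fsubsetUr.
Qed.

Lemma l2s_fsubset (F G : {fset J}) (x : J -> R[i]) : (F `<=` G)%fset ->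
  l2s F x <= l2s G x.
Proof.
by move=> /fsubsetP FG; apply: l2s_subset.
Qed.

Lemma net_lim_norm (x : ell2) :
  net_lim (fun F => (l2s F (val x) ^+ 2)%:C%C) (sn_norm x ^+ 2)%:C%C.
Proof.
move=> eps e0; have N0 := sn_norm_ge0 x.
have N1 : 0 < 2 * sn_norm x + 1 by rewrite ltr_wpDl // mulr_ge0.
have d0 : 0 < eps / (2 * sn_norm x + 1) by rewrite divr_gt0.
have [_ [F0 _ <-] F0x] := sup_adherent d0 (sn_has_sup x).
exists F0 => F F0F.
have FF : l2s F0 (val x) <= l2s F (val x) by exact: l2s_fsubset.
rewrite -rmorphB normc_real.
have Fx : l2s F (val x) <= sn_norm x := sn_le_norm x F.
have F0' : 0 <= l2s F (val x) by exact: l2s_ge0.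
rewrite subr_sqr ger0_norm; last by rewrite mulr_ge0 ?subr_ge0 ?addr_ge0.
have ltd : sn_norm x - l2s F (val x) <= eps / (2 * sn_norm x + 1).
  by rewrite lerBlDr -lerBlDl; apply: le_trans (ltW F0x) FF.
apply: le_trans (ler_pM _ _ ltd (_ : _ <= 2 * sn_norm x + 1)) _;
  rewrite ?subr_ge0 ?addr_ge0 //; first lra.
by rewrite divfK ?gt_eqF.
Qed.

Lemma net_lim_le (f : {fset J} -> R) (c B : R) :
  net_lim (fun F => (f F)%:C%C) c%:C%C -> (forall F, f F <= B) -> c <= B.
Proof.
move=> fc fB; apply/ler_addgt0Pl => eps e0; have [F0 h] := fc _ e0.
have := h F0 (fsubset_refl _); rewrite -rmorphB normc_real => /ler_normlW.
by rewrite lerBlDr => /le_trans; apply; rewrite lerD2l.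
Qed.

(** The truncated norms converge along the finite sets, hence so does a finite sum of their squares,
    and a bound uniform in [F] passes to the limit. One [F] is shared by all the rows. *)
Lemma sum_sn_norm_le n (u : 'I_n -> ell2) (B : R) :
  (forall F : {fset J}, \sum_a l2s F (val (u a)) ^+ 2 <= B) ->
  \sum_a sn_norm (u a) ^+ 2 <= B.
Proof.
apply: net_lim_le.
suff H (s : seq 'I_n) : net_lim (fun F => (\sum_(a <- s) l2s F (val (u a)) ^+ 2)%:C%C)
  (\sum_(a <- s) sn_norm (u a) ^+ 2)%:C%C by exact: H.
elim: s => [|a s IH].
  by move=> eps e0; exists fset0 => F _; rewrite !big_nil subrr normc0 ltW.
rewrite big_cons rmorphD.
have -> : (fun F : {fset J} => (\sum_(b <- a :: s) l2s F (val (u b)) ^+ 2)%:C%C) =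
  (fun F : {fset J} => (l2s F (val (u a)) ^+ 2)%:C%C) +
  (fun F : {fset J} => (\sum_(b <- s) l2s F (val (u b)) ^+ 2)%:C%C).
  by apply/funext => F; rewrite big_cons rmorphD.
by apply: net_limD => //; exact: net_lim_norm.
Qed.

Definition fin_inner (x y : J -> R[i]) (F : {fset J}) : R[i] :=
  \sum_(j <- F) x j * (y j)^*%C.

(** Defining the inner product by polarization avoids summing a series. [net_lim_inner] then
    identifies it with the limit of the finite sums, from which its algebraic properties are read
    off. *)
Definition ell2_inner (x y : ell2) : R[i] :=
  4%:R^-1 * ((sn_norm (x + y) ^+ 2)%:C%C - (sn_norm (x - y) ^+ 2)%:C%C +
    'i%C * ((sn_norm (x + 'i%C *: y) ^+ 2)%:C%C - (sn_norm (x - 'i%C *: y) ^+ 2)%:C%C)).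

Lemma sqr_normcE (z : R[i]) : (normc z ^+ 2)%:C%C = z * z^*%C.
Proof. by rewrite rmorphXn /= -normcE_norm sqr_normc. Qed.

Lemma conjcD (u v : R[i]) : (u + v)^*%C = u^*%C + v^*%C.
Proof. exact: rmorphD. Qed.

Lemma conjcN (u : R[i]) : (- u)^*%C = - u^*%C.
Proof. exact: rmorphN. Qed.

Lemma conjcM (u v : R[i]) : (u * v)^*%C = u^*%C * v^*%C.
Proof. exact: rmorphM. Qed.

Lemma polarization (a b : R[i]) : a * b^*%C =
  4%:R^-1 * ((normc (a + b) ^+ 2)%:C%C - (normc (a - b) ^+ 2)%:C%C +
    'i%C * ((normc (a + 'i%C * b) ^+ 2)%:C%C - (normc (a - 'i%C * b) ^+ 2)%:C%C)).
Proof.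
have i2 : ('i%C : R[i]) ^+ 2 = -1 by exact: sqr_i.
have ic : ('i%C : R[i])^*%C = - 'i%C by apply/eqP; rewrite eq_complex /= oppr0 !eqxx.
rewrite !sqr_normcE !conjcD !conjcN !conjcM ic.
have -> : (a + b) * (a^* + b^*)%C - (a - b) * (a^* - b^*)%C +
  'i%C * ((a + 'i%C * b) * (a^* + - 'i%C * b^*)%C -
  (a - 'i%C * b) * (a^* - - 'i%C * b^*)%C) =
  2%:R * (a * b^*%C + b * a^*%C) + 2%:R * 'i%C ^+ 2 * (b * a^*%C - a * b^*%C) by ring.
by rewrite i2; field.
Qed.

Lemma fin_inner_polarization (x y : J -> R[i]) : fin_inner x y =
  4%:R^-1 *: ((fun F => (l2s F (x + y) ^+ 2)%:C%C) - (fun F => (l2s F (x - y) ^+ 2)%:C%C) +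
    'i%C *: ((fun F => (l2s F (x + 'i%C *: y) ^+ 2)%:C%C) -
             (fun F => (l2s F (x - 'i%C *: y) ^+ 2)%:C%C))).
Proof.
apply/funext => F; rewrite /fin_inner; under eq_bigr do rewrite polarization.
rewrite -mulr_sumr; congr (_ * _); rewrite big_split /= -mulr_sumr !sumrB.
by rewrite !fctE /= !l2s_sqr !rmorph_sum.
Qed.

Lemma net_lim_inner (x y : ell2) :
  net_lim (fin_inner (val x) (val y)) (ell2_inner x y).
Proof.
rewrite fin_inner_polarization; apply/net_limZ/net_limD.
  by apply/net_limD/net_limN; exact: net_lim_norm.
by apply/net_limZ/net_limD/net_limN; exact: net_lim_norm.
Qed.

Lemma fin_innerDl (x x' y : J -> R[i]) :
  fin_inner (x + x') y = fin_inner x y + fin_inner x' y.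
Proof.
apply/funext => F; rewrite -[RHS]/(fin_inner x y F + fin_inner x' y F) -big_split.
by apply: eq_bigr => j _; exact: mulrDl.
Qed.

Lemma fin_innerZl c (x y : J -> R[i]) : fin_inner (c *: x) y = c *: fin_inner x y.
Proof.
apply/funext => F; rewrite -[RHS]/(c * fin_inner x y F) mulr_sumr.
by apply: eq_bigr => j _; rewrite [RHS]mulrA.
Qed.

Lemma ell2_innerDl x x' y : ell2_inner (x + x') y = ell2_inner x y + ell2_inner x' y.
Proof.
apply: (@net_lim_unique (fin_inner (val (x + x')) (val y))).
  exact: net_lim_inner.
by rewrite fin_innerDl; apply: net_limD; exact: net_lim_inner.
Qed.

Lemma ell2_innerZl c x y : ell2_inner (c *: x) y = c * ell2_inner x y.
Proof.
apply: (@net_lim_unique (fin_inner (val (c *: x)) (val y))).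
  exact: net_lim_inner.
by rewrite fin_innerZl; apply: net_limZ; exact: net_lim_inner.
Qed.

Lemma ell2_inner_conj x y : ell2_inner x y = (ell2_inner y x)^*%C.
Proof.
apply: (net_lim_unique (net_lim_inner x y)) => eps e0.
have [F0 h] := net_lim_inner y x e0; exists F0 => F /h.
suff -> : fin_inner (val x) (val y) F = (fin_inner (val y) (val x) F)^*%C.
  by rewrite -rmorphB /= -[normc (_ ^*)]/(complex.Re (normc _)%:C%C) -normcE_norm normcJ.
by rewrite /fin_inner rmorph_sum /=; apply: eq_bigr => j _; rewrite rmorphM /= conjcK mulrC.
Qed.

Lemma ell2_inner_norm x : `|x| ^+ 2 = ell2_inner x x.
Proof.
rewrite normr_sn -rmorphXn; apply: (net_lim_unique (net_lim_norm x)).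
suff -> : (fun F : {fset J} => (l2s F (val x) ^+ 2)%:C%C) = fin_inner (val x) (val x).
  exact: net_lim_inner.
by apply/funext => F; rewrite l2s_sqr rmorph_sum; apply: eq_bigr => j _; exact: sqr_normcE.
Qed.

Lemma ell2_innerZr c x y : ell2_inner x (c *: y) = c^*%C * ell2_inner x y.
Proof.
by rewrite (ell2_inner_conj x (c *: y)) (ell2_inner_conj x y) ell2_innerZl conjcM.
Qed.

Lemma ell2_innerDr x y y' : ell2_inner x (y + y') = ell2_inner x y + ell2_inner x y'.
Proof.
by rewrite (ell2_inner_conj x (y + y')) (ell2_inner_conj x y) (ell2_inner_conj x y')
  ell2_innerDl conjcD.
Qed.

Lemma ell2_inner_zmodl y : zmod_morphism (ell2_inner^~ y).
Proof. by move=> u v; rewrite ell2_innerDl -scaleN1r ell2_innerZl mulN1r. Qed.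

Lemma ell2_inner_zmodr x : zmod_morphism (ell2_inner x).
Proof.
move=> u v; rewrite ell2_innerDr -scaleN1r ell2_innerZr.
by rewrite conjcN [1^*%C]rmorph1 mulN1r.
Qed.

Lemma ell2_inner_scalel y : scalable_for ( *%R : R[i] -> R[i] -> R[i]) (ell2_inner^~ y).
Proof. by move=> c u; exact: ell2_innerZl. Qed.

Lemma ell2_inner_scaler x :
  scalable_for ((Num.conj : R[i] -> R[i]) \; *%R) (ell2_inner x).
Proof. by move=> c u; exact: ell2_innerZr. Qed.

HB.instance Definition _ := isBilinear.Build R[i] ell2 ell2 R[i] ( *%R )
  (Num.conj \; *%R) ell2_inner ell2_inner_zmodl ell2_inner_zmodr
  ell2_inner_scalel ell2_inner_scaler.

Lemma ell2_inner_hermitian (x y : ell2) :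
  ell2_inner x y = (-1) ^+ false * Num.conj (ell2_inner y x).
Proof. by rewrite expr0 mul1r; exact: ell2_inner_conj. Qed.

HB.instance Definition _ := isHermitianSesquilinear.Build R[i] ell2 false Num.conj
  ell2_inner ell2_inner_hermitian.

Lemma ell2_inner_gt0 (x : ell2) : x != 0 -> 0 < ell2_inner x x.
Proof. by move=> x0; rewrite -ell2_inner_norm exprn_gt0 // normr_gt0. Qed.

HB.instance Definition _ := isDotProduct.Build R[i] ell2 ell2_inner ell2_inner_gt0.

Definition ell2_hilbert : hilbertSpace R :=
  @HilbertSpace R ell2 ell2_inner ell2_inner_norm.

End HilbertSpace.

Arguments ell2_family R J : clear implicits.
Arguments ell2 R J : clear implicits.
Arguments ell2_hilbert R J : clear implicits.

(** * Operator spaces of column operators *)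

(* A vector x acts on l2(tag * nat) by (x h)(t, i) = h(t, 0) * cs t x i: a direct sum over
   the tags of column operators, of norm sup_t |cs t x|_2.  Scalar functionals are columns
   of height one. *)
Record columnSystem (R : realType) (D : seminormFamily R) := ColumnSystem {
  cs_tag : Type;
  cs : cs_tag -> (sn_index D -> R[i]) -> nat -> R[i];
  csD : forall t x y i, cs t (x + y) i = cs t x i + cs t y i;
  csZ : forall t c x i, cs t (c *: x) i = c * cs t x i;
  cs_bounded : forall t L, exists d, forall x, l2s (iota 0 L) (cs t x) <= sn d x;
  cs_norming : forall d x, exists t L, sn d x <= l2s (iota 0 L) (cs t x) }.

Section ColumnSystem.
Context {R : realType} (D : seminormFamily R) (W : columnSystem D).
Local Notation raw := (sn_index D -> R[i]).

Lemma cs0 t i : @cs _ _ W t 0 i = 0.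
Proof. by rewrite -(scale0r 0) csZ mul0r. Qed.

Lemma csN t x i : @cs _ _ W t (- x) i = - cs t x i.
Proof. by rewrite -scaleN1r csZ mulN1r. Qed.

Lemma cs_le_norm (u : sn_space D) t L :
  l2s (iota 0 L) (@cs _ _ W t (val u)) <= sn_norm u.
Proof.
by have [d h] := cs_bounded t L; apply: le_trans (h _) (sn_le_norm _ _).
Qed.

(** For every tag and height, the scalar matrix with rows (a, i), columns b and entries
    [cs t (x a b) i] has norm at most |B|. By [mxnorm_le] and [col_le_mxnorm] this expresses the
    matrix norm without the Hilbert space, and all later estimates are made in this form. *)
Definition col_le (n : nat) (B : R) (x : 'I_n -> 'I_n -> raw) : Prop :=
  forall (t : cs_tag W) (L : nat) (xi : 'I_n -> R[i]),
    \sum_a \sum_(i <- iota 0 L) normc (\sum_b xi b * cs t (x a b) i) ^+ 2 <=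
    B ^+ 2 * \sum_b normc (xi b) ^+ 2.

Definition col_index : choiceType := ({classic cs_tag W} * nat)%type.

Definition col_act (x : raw) (h : col_index -> R[i]) : col_index -> R[i] :=
  fun j => h (j.1, 0%N) * cs (j.1 : cs_tag W) x j.2.

(** The action reads [h] only at the points (t, 0). Enlarging [F] to a product of finitely many tags
    with an initial segment splits the sum by tags; [col_le] applies to each of them, and [G]
    collects the points (t, 0). *)
Lemma col_act_le n (B : R) (x : 'I_n -> 'I_n -> raw) (F : {fset col_index}) :
  col_le B x -> exists G : {fset col_index}, forall h : 'I_n -> col_index -> R[i],
  \sum_a \sum_(j <- F) normc (\sum_b col_act (x a b) (h b) j) ^+ 2 <=
  B ^+ 2 * \sum_b \sum_(j <- G) normc (h b j) ^+ 2.
Proof.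
move=> xB; pose T := undup (map fst F).
have [L FL] : exists L, forall j, j \in F -> (j.2 < L)%N.
  exists (\max_(j <- F) j.2).+1 => j jF.
  by rewrite ltnS (@leq_bigmax_seq _ _ xpredT (fun j : col_index => j.2)).
pose S := [seq (t, 0%N) | t <- T]; exists [fset j in S]%fset => h.
have FS : {subset F <= [seq (t, i) | t <- T, i <- iota 0 L]}.
  move=> [t i] tF; apply/allpairsP; exists (t, i); split => //=.
    by rewrite mem_undup; apply/mapP; exists (t, i).
  by rewrite mem_iota add0n; exact: FL tF.
apply: (@le_trans _ _ (\sum_a \sum_(t <- T) \sum_(i <- iota 0 L)
    normc (\sum_b h b (t, 0%N) * cs (t : cs_tag W) (x a b) i) ^+ 2)).
  apply: ler_sum => a _; rewrite -(big_allpairs (F := fun j : col_index =>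
    normc (\sum_b h b (j.1, 0%N) * cs (j.1 : cs_tag W) (x a b) j.2) ^+ 2)).
  by apply: ler_sum_subset => // j; exact: sqr_ge0.
rewrite exchange_big /=.
apply: (@le_trans _ _ (\sum_(t <- T) B ^+ 2 * \sum_b normc (h b (t, 0%N)) ^+ 2)).
  by apply: ler_sum => t _; exact: xB.
rewrite -mulr_sumr ler_wpM2l ?sqr_ge0 // exchange_big ler_sum // => b _.
rewrite -[leLHS](big_map (fun t => (t, 0%N)) predT (fun j => normc (h b j) ^+ 2)).
apply: ler_sum_subset => [j|| j jS]; first exact: sqr_ge0.
  by rewrite map_inj_uniq ?undup_uniq // => u v [].
by rewrite !inE.
Qed.

Lemma col_le1 (u : sn_space D) : col_le (sn_norm u) (fun _ _ : 'I_1 => val u).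
Proof.
move=> t L xi; rewrite !big_ord1; under eq_bigr do rewrite big_ord1 normcM exprMn.
rewrite -mulr_sumr mulrC ler_wpM2r ?sqr_ge0 // -l2s_le ?sn_norm_ge0 //.
exact: cs_le_norm.
Qed.

Lemma col_act_bound (u : sn_space D) (h : ell2 R col_index) (F : {fset col_index}) :
  l2s F (col_act (val u) (val h)) <= sn_norm u * sn_norm h.
Proof.
have [G /(_ (fun=> val h))] := col_act_le F (col_le1 u).
rewrite !big_ord1; under eq_bigr do rewrite big_ord1.
move=> H; rewrite l2s_le ?mulr_ge0 ?sn_norm_ge0 //.
apply: le_trans H _; rewrite exprMn ler_wpM2l ?sqr_ge0 // -l2s_le ?sn_norm_ge0 //.
exact: (sn_le_norm h G).
Qed.

Lemma col_act_mem (u : sn_space D) (h : ell2 R col_index) :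
  sn_mem (s := ell2_family R col_index) (col_act (val u) (val h)).
Proof.
by exists (sn_norm u * sn_norm h) => F; exact: col_act_bound.
Qed.

Definition col_emb (u : sn_space D) (h : ell2 R col_index) : ell2 R col_index :=
  sn_mk (col_act_mem u h).

Lemma col_actBl x y h : col_act (x - y) h = col_act x h - col_act y h.
Proof.
apply/funext => j; rewrite -[RHS]/(_ * _ - _ * _) -mulrBr; congr (_ * _).
by rewrite csD -scaleN1r csZ mulN1r.
Qed.

Lemma col_actBr x h k : col_act x (h - k) = col_act x h - col_act x k.
Proof. by apply/funext => j; exact: mulrBl. Qed.

Lemma col_actZl c x h : col_act (c *: x) h = c *: col_act x h.
Proof.
apply/funext => j; rewrite -[RHS]/(c * (_ * _)) mulrCA; congr (_ * _).
exact: csZ.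
Qed.

Lemma col_actZr c x h : col_act x (c *: h) = c *: col_act x h.
Proof. by apply/funext => j; exact/esym/mulrA. Qed.

Lemma col_emb_zmodl h : zmod_morphism (col_emb^~ h).
Proof. by move=> u v; apply/val_inj; exact: col_actBl. Qed.

Lemma col_emb_zmodr u : zmod_morphism (col_emb u).
Proof. by move=> h k; apply/val_inj; exact: col_actBr. Qed.

Lemma col_emb_scalel h : scalable (col_emb^~ h).
Proof. by move=> c u; apply/val_inj; exact: col_actZl. Qed.

Lemma col_emb_scaler u : scalable (col_emb u).
Proof. by move=> c h; apply/val_inj; exact: col_actZr. Qed.

HB.instance Definition _ := isBilinear.Build R[i] (sn_space D) (ell2 R col_index)
  (ell2 R col_index) *:%R *:%R col_emb col_emb_zmodl col_emb_zmodr
  col_emb_scalel col_emb_scaler.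

Lemma delta_mem (j : col_index) (c : R[i]) :
  sn_mem (s := ell2_family R col_index) (fun i => if i == j then c else 0).
Proof.
by exists (normc c) => F; apply: l2s_single; exact: fset_uniq.
Qed.

Definition ell2_delta (j : col_index) (c : R[i]) : ell2 R col_index :=
  sn_mk (delta_mem j c).

Lemma norm_ell2_delta j c : sn_norm (ell2_delta j c) = normc c.
Proof.
apply/eqP; rewrite eq_le; apply/andP; split.
  by apply: sn_norm_le => F; apply: l2s_single; exact: fset_uniq.
by apply: le_trans (normc_sn_norm (ell2_delta j c) j); rewrite /= eqxx.
Qed.

Definition col_fiber (t : cs_tag W) (L : nat) : seq col_index :=
  [seq ((t : {classic cs_tag W}), i) | i <- iota 0 L].

Lemma col_fiber_uniq t L : uniq (col_fiber t L).
Proof. by rewrite map_inj_uniq ?iota_uniq // => i j []. Qed.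

Lemma sn_l2s_le (h : ell2 R col_index) (s : seq col_index) : uniq s ->
  l2s s (val h) <= sn_norm h.
Proof.
move=> us; apply: le_trans (sn_le_norm h [fset j in s]%fset).
by apply: l2s_subset => // j; rewrite !inE.
Qed.

Lemma col_emb_isometry (u : sn_space D) :
  opnorm vnorm vnorm (col_emb u) = (vnorm u)%:E.
Proof.
rewrite vnorm_sn; apply/eqP; rewrite eq_le; apply/andP; split.
  apply: ge_ereal_sup => _ [h /= h1 <-]; rewrite lee_fin vnorm_sn.
  apply: sn_norm_le => F; apply: le_trans (col_act_bound u h F) _.
  by rewrite ler_piMr ?sn_norm_ge0.
suff Hd d : ((sn d (val u))%:E <= opnorm vnorm vnorm (col_emb u))%E.
  have : ((sn (sn_dir0 D) (val u))%:E <= opnorm vnorm vnorm (col_emb u))%E by exact: Hd.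
  case E : (opnorm _ _ _) => [r| |] h; last by [].
    by rewrite lee_fin; apply: sn_norm_le => d; rewrite -lee_fin -E.
  exact: leey.
(* The unit vector at (t, 0) is sent to the column [cs t (val u)] in the fibre of [t], so a norming
   tag gives the lower bound. *)
have [t [L utL]] := cs_norming W d (val u).
apply: (@le_trans _ _ (vnorm (col_emb u (ell2_delta (t, 0%N) 1)))%:E); last first.
  by apply: ereal_sup_ubound; exists (ell2_delta (t, 0%N) 1); rewrite //= vnorm_sn norm_ell2_delta normc1.
rewrite lee_fin vnorm_sn; apply: le_trans utL _.
apply: le_trans (sn_l2s_le _ (col_fiber_uniq t L)).
by rewrite l2s_map; apply: ler_l2s => i; rewrite /= /col_act /= eqxx mul1r.
Qed.

Definition col_space : operatorSpace R :=
  @OperatorSpace R (sn_space D) (ell2_hilbert R col_index) col_emb col_emb_isometry.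

Definition raw_mx n (x : 'M[col_space]_n) : 'I_n -> 'I_n -> raw :=
  fun a b => val (x a b : sn_space D).

Lemma l2norm_sqr n (xi : {ffun 'I_n -> ell2 R col_index}) :
  l2norm xi ^+ 2 = \sum_a sn_norm (xi a) ^+ 2.
Proof. by rewrite sqr_sqrtr // sumr_ge0 // => a _; exact: sqr_ge0. Qed.

Lemma val_mxop n (x : 'M[col_space]_n) (xi : {ffun 'I_n -> ell2 R col_index}) a j :
  val (mxop (map_mx (os_emb col_space) x) xi a : ell2 R col_index) j =
  \sum_b col_act (raw_mx x a b) (val (xi b)) j.
Proof.
rewrite ffunE raddf_sum fct_sumE.
by apply: eq_bigr => b _; rewrite mxE.
Qed.

Lemma mxnorm_le n (B : R) (x : 'M[col_space]_n) :
  0 <= B -> col_le B (raw_mx x) -> mxnorm x <= B.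
Proof.
move=> B0 xB; rewrite -lee_fin fineK ?mxnorm_fin_num //.
apply: ge_ereal_sup => _ [xi /= xi1 <-]; rewrite lee_fin.
rewrite -(@ler_pXn2r _ 2) ?nnegrE ?sqrtr_ge0 // l2norm_sqr.
apply: sum_sn_norm_le => F; have [G /(_ (fun b => val (xi b)))] := col_act_le F xB.
under eq_bigr do under eq_bigr do rewrite -val_mxop.
move=> H; under eq_bigr do rewrite l2s_sqr.
apply: le_trans H _; rewrite ler_piMr ?sqr_ge0 //.
apply: (@le_trans _ _ (l2norm xi ^+ 2)); last by rewrite expr_le1 ?sqrtr_ge0.
rewrite l2norm_sqr; apply: ler_sum => b _.
by rewrite -l2s_le ?sn_norm_ge0 //; exact: (sn_le_norm (xi b) G).
Qed.

(** The vector [xi], normalized by the square root of [rho2], is placed at the coordinate (t, 0) of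
    each of the n copies of the Hilbert space; on the fibre of [t] the operator then reproduces the
    scalar sums. *)
Lemma col_le_mxnorm n (x : 'M[col_space]_n) : col_le (mxnorm x) (raw_mx x).
Proof.
move=> t L xi; set rho2 : R := \sum_b normc (xi b) ^+ 2.
have rho0 : 0 <= rho2 by apply: sumr_ge0 => b _; exact: sqr_ge0.
have [rho_eq0|rho_neq0] := eqVneq rho2 0.
  rewrite rho_eq0 mulr0 big1 // => a _; rewrite big1 // => i _.
  rewrite big1 ?normc0 ?expr0n // => b _.
  suff /eqP : normc (xi b) ^+ 2 = 0.
    by rewrite sqrf_eq0 => /eqP/eq0_normc ->; rewrite mul0r.
  apply/eqP; rewrite eq_le sqr_ge0 andbT -rho_eq0 /rho2 (bigD1 b) //= lerDl.
  by apply: sumr_ge0 => c _; exact: sqr_ge0.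
pose r := (Num.sqrt rho2)^-1.
have r2 : r ^+ 2 = rho2^-1 by rewrite exprVn sqr_sqrtr.
pose eta : {ffun 'I_n -> ell2 R col_index} :=
  [ffun b => ell2_delta (t, 0%N) (r%:C%C * xi b)].
have eta1 : l2norm eta <= 1.
  rewrite -(@expr_le1 _ 2) ?sqrtr_ge0 // l2norm_sqr.
  under eq_bigr do rewrite ffunE norm_ell2_delta normcM exprMn normc_real real_normK ?num_real //.
  by rewrite -mulr_sumr r2 mulVf.
have xeta : l2norm (mxop (map_mx (os_emb col_space) x) eta) <= mxnorm x.
  by rewrite -lee_fin fineK ?mxnorm_fin_num //; apply: ereal_sup_ubound; exists eta.
have N0 : 0 <= mxnorm x by apply: le_trans xeta; exact: sqrtr_ge0.
move: xeta; rewrite -(@ler_pXn2r _ 2) ?nnegrE ?sqrtr_ge0 // l2norm_sqr => H.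
 rewrite -ler_pdivrMr ?lt_def ?rho_neq0 //.
apply: le_trans H; rewrite mulr_suml; apply: ler_sum => a _.
apply: (@le_trans _ _ (l2s (col_fiber t L)
   (val (mxop (map_mx (os_emb col_space) x) eta a : ell2 R col_index)) ^+ 2)).
  rewrite l2s_sqr big_map mulrC -r2 mulr_sumr; apply: ler_sum => i _.
  rewrite val_mxop -[X in X ^+ 2 * _]ger0_norm ?invr_ge0 ?sqrtr_ge0 //.
  rewrite -normc_real -exprMn -normcM mulr_sumr.
  rewrite le_eqVlt; apply/orP; left; apply/eqP; congr (normc _ ^+ 2); apply: eq_bigr => b _.
  by rewrite /col_act /= ffunE /= eqxx mulrA.
rewrite lerXn2r ?nnegrE ?l2s_ge0 ?sn_norm_ge0 //.
exact/sn_l2s_le/col_fiber_uniq.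
Qed.

Lemma mxnorm_ge0 n (x : 'M[col_space]_n) : 0 <= mxnorm x.
Proof.
apply: (@le_trans _ _ (l2norm (mxop (map_mx (os_emb col_space) x) 0))).
  exact: sqrtr_ge0.
rewrite -lee_fin fineK ?mxnorm_fin_num //; apply: ereal_sup_ubound; exists 0 => //=.
rewrite /l2norm big1 ?sqrtr0 // => i _.
by rewrite ffunE vnorm0 expr0n.
Qed.

Lemma sum2_l2s n L (f : 'I_n -> nat -> R[i]) :
  \sum_a \sum_(i <- iota 0 L) normc (f a i) ^+ 2 =
  l2s [seq (a, i) | a <- index_enum 'I_n, i <- iota 0 L] (fun p => f p.1 p.2) ^+ 2.
Proof. by rewrite l2s_sqr big_allpairs. Qed.

Lemma col_leD n B C (x y : 'I_n -> 'I_n -> raw) : 0 <= B -> 0 <= C ->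
  col_le B x -> col_le C y -> col_le (B + C) (fun a b => x a b + y a b).
Proof.
move=> B0 C0 xB yC t L xi; have := xB t L xi; have := yC t L xi.
set rho := \sum_b normc (xi b) ^+ 2.
have rho0 : 0 <= rho by apply: sumr_ge0 => b _; exact: sqr_ge0.
rewrite -{1 2 3}(sqr_sqrtr rho0) -!exprMn !sum2_l2s.
rewrite !ler_pXn2r ?nnegrE ?mulr_ge0 ?addr_ge0 ?sqrtr_ge0 ?l2s_ge0 // => yr xr.
rewrite mulrDl; apply: le_trans (lerD xr yr); apply: le_trans (l2sD _ _ _).
apply: ler_l2s => -[a i]; rewrite fctE /= -big_split /=.
by under eq_bigr do rewrite csD mulrDr.
Qed.

Lemma col_leN n B (x : 'I_n -> 'I_n -> raw) :
  col_le B x -> col_le B (fun a b => - x a b).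
Proof.
move=> xB t L xi; apply: le_trans (xB t L xi).
apply: ler_sum => a _; apply: ler_sum => i _.
rewrite -normcN -sumrN; under eq_bigr do rewrite csN mulrN opprK.
by [].
Qed.

Lemma eq_col_le n B (x y : 'I_n -> 'I_n -> raw) :
  (forall a b, x a b = y a b) -> col_le B x -> col_le B y.
Proof.
by move=> xy xB t L xi; under eq_bigr do under eq_bigr do under eq_bigr do rewrite -xy.
Qed.

(** Each of the n rows contributes at most n^2 eta^2 rho, so the total is at most n^3 eta^2 rho.
    Rounding n^3 up to n^4 keeps the factor in front of [eta] an integer. *)
Lemma col_le_entries n (eta : R) (x : 'I_n -> 'I_n -> raw) :
  (forall a b d, sn d (x a b) <= eta) -> col_le ((n ^ 2)%:R * eta) x.
Proof.
move=> xeta t L xi; set rho : R := \sum_b normc (xi b) ^+ 2.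
have rho0 : 0 <= rho by apply: sumr_ge0 => b _; exact: sqr_ge0.
have [n0|n0] := posnP n; first by subst n; rewrite !big_ord0 mulr_ge0 ?sqr_ge0.
have eta0 : 0 <= eta.
  by apply: le_trans (xeta (Ordinal n0) (Ordinal n0) (sn_dir0 D)); exact: sn_ge0.
have xirho b : normc (xi b) <= Num.sqrt rho.
  rewrite -[leLHS]ger0_norm ?normc_ge0 // -sqrtr_sqr ler_wsqrtr //.
  by rewrite /rho (bigD1 b) //= lerDl sumr_ge0 // => c _; exact: sqr_ge0.
have row_le a : \sum_(i <- iota 0 L) normc (\sum_b xi b * cs t (x a b) i) ^+ 2 <=
    (n%:R * eta * Num.sqrt rho) ^+ 2.
  rewrite -l2s_sqr ler_pXn2r ?nnegrE ?mulr_ge0 ?sqrtr_ge0 ?l2s_ge0 //.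
  have -> : (fun i => \sum_b xi b * cs t (x a b) i) = \sum_b xi b *: cs t (x a b).
    by apply/funext => i; rewrite fct_sumE.
  apply: le_trans (l2s_sum _ _ _) _.
  apply: (@le_trans _ _ (\sum_(b < n) eta * Num.sqrt rho)).
    apply: ler_sum => b _; rewrite l2sZ mulrC ler_pM ?l2s_ge0 ?normc_ge0 //.
    by have [d h] := cs_bounded t L; exact: le_trans (h _) (xeta a b d).
  by rewrite sumr_const card_ord -[leLHS]mulr_natl mulrA.
apply: le_trans (ler_sum _ (fun a _ => row_le a)) _.
rewrite sumr_const card_ord -[leLHS]mulr_natl.
rewrite !exprMn sqr_sqrtr // mulrA ler_wpM2r // mulrA ler_wpM2r ?sqr_ge0 //.
by rewrite -!natrX -natrM ler_nat -expnM -expnS leq_pexp2l.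
Qed.

Lemma col_le_entry n B (x : 'I_n -> 'I_n -> raw) a b t L : 0 <= B -> col_le B x ->
  l2s (iota 0 L) (@cs _ _ W t (x a b)) <= B.
Proof.
move=> B0 /(_ t L (fun c => (c == b)%:R)); rewrite l2s_le //.
rewrite (bigD1 a) //= [X in _ <= X](_ : _ = B ^+ 2); last first.
  rewrite (bigD1 b) //= eqxx normc1 expr1n big1 ?addr0 ?mulr1 // => c /negbTE ->.
  by rewrite normc0 expr0n.
apply: le_trans; rewrite -[leLHS]addr0 lerD //; last first.
  by apply: sumr_ge0 => c _; apply: sumr_ge0 => i _; exact: sqr_ge0.
apply: ler_sum => i _; rewrite (bigD1 b) //= eqxx mul1r big1 ?addr0 // => c /negbTE ->.
by rewrite mul0r.
Qed.

Lemma sn_raw_mx n (x : 'M[col_space]_n) a b d : sn d (raw_mx x a b) <= mxnorm x.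
Proof.
have [t [L h]] := cs_norming W d (raw_mx x a b); apply: le_trans h _.
by apply: col_le_entry (col_le_mxnorm x); exact: mxnorm_ge0.
Qed.

Lemma vnorm_entry n (x : 'M[col_space]_n) a b : vnorm (x a b) <= mxnorm x.
Proof. by rewrite vnorm_sn; apply: sn_norm_le => d; exact: sn_raw_mx. Qed.

Lemma col_le_single n (u : sn_space D) (a0 b0 : 'I_n) :
  col_le (sn_norm u) (fun a b => if (a == a0) && (b == b0) then val u else 0).
Proof.
move=> t L xi; rewrite (bigD1 a0) //= [X in _ + X]big1 ?addr0; last first.
  move=> a /negbTE ->; rewrite big1 // => i _.
  by rewrite big1 ?normc0 ?expr0n // => b _; rewrite cs0 mulr0.
apply: (@le_trans _ _ (normc (xi b0) ^+ 2 * l2s (iota 0 L) (@cs _ _ W t (val u)) ^+ 2)).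
  rewrite l2s_sqr mulr_sumr; apply: ler_sum => i _.
  rewrite (bigD1 b0) //= !eqxx /= big1 ?addr0 ?normcM ?exprMn // => b /negbTE ->.
  by rewrite cs0 mulr0.
rewrite mulrC ler_pM ?sqr_ge0 //.
  by rewrite ler_pXn2r ?nnegrE ?l2s_ge0 ?sn_norm_ge0 // cs_le_norm.
by rewrite (bigD1 b0) //= lerDl sumr_ge0 // => b _; exact: sqr_ge0.
Qed.

End ColumnSystem.

(** * Cells and weighted path spaces *)

Section Variation.
Context {R : realType}.
Implicit Types (a : nat -> nat -> R[i]) (M : nat).

(** One [M] truncates both the number of blocks and their height, so finitely many coordinates are
    involved; the supremum over [M] is the l1-sum of the l2 norms of the blocks. With y as block 0
    and the increments of s as the others, this is |y| + var(s). *)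
Definition pvar M a : R := \sum_(0 <= m < M) l2s (iota 0 M) (a m).

Lemma pvar_ge0 M a : 0 <= pvar M a.
Proof. by apply: sumr_ge0 => m _; exact: l2s_ge0. Qed.

Lemma pvarD M a a' : pvar M (a + a') <= pvar M a + pvar M a'.
Proof. by rewrite -big_split /=; apply: ler_sum => m _; exact: l2sD. Qed.

Lemma pvarZ M c a : pvar M (fun m j => c * a m j) = normc c * pvar M a.
Proof. by rewrite mulr_sumr; apply: eq_bigr => m _; rewrite -l2sZ. Qed.

Lemma l2s_iota M M' (x : nat -> R[i]) : (M <= M')%N ->
  l2s (iota 0 M) x <= l2s (iota 0 M') x.
Proof.
move=> MM'; apply: l2s_subset; first exact: iota_uniq.
by move=> j; rewrite !mem_iota !add0n => /leq_trans; apply.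
Qed.

Lemma l2s_le_pvar M m a : (m < M)%N -> l2s (iota 0 M) (a m) <= pvar M a.
Proof.
move=> mM; rewrite /pvar big_mkord (bigD1 (Ordinal mM)) //= lerDl.
by apply: sumr_ge0 => i _; exact: l2s_ge0.
Qed.

Lemma normc_le_pvar M m j a : (m < M)%N -> (j < M)%N -> normc (a m j) <= pvar M a.
Proof.
move=> mM jM; apply: le_trans (l2s_le_pvar a mM); apply: normc_le_l2s.
by rewrite mem_iota.
Qed.

Lemma pvar_le_sum M a :
  pvar M a <= \sum_(0 <= m < M) \sum_(0 <= j < M) normc (a m j).
Proof.
apply: ler_sum => m _; apply: le_trans (l2s_le_sum _ _) _.
by rewrite /index_iota subn0.
Qed.

Lemma sum_normc_le_pvar M M' j a : (M <= M')%N -> (j < M')%N ->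
  normc (\sum_(1 <= m < M) a m j) <= pvar M' a.
Proof.
move=> MM' jM; apply: le_trans (le_normc_sum _ _) _.
apply: (@le_trans _ _ (\sum_(0 <= m < M') normc (a m j))); last first.
  by apply: ler_sum => m _; apply: normc_le_l2s; rewrite mem_iota.
case: M MM' => [|M] MM'; first by rewrite big_geq // sumr_ge0 // => m _; exact: normc_ge0.
rewrite (big_cat_nat (leq0n _) MM') //= [X in _ <= X + _]big_ltn // addrAC lerDr addr_ge0 ?normc_ge0 //.
by apply: sumr_ge0 => m _; exact: normc_ge0.
Qed.

End Variation.

Section WeightedSpace.
Context {R : realType}.

Definition cell_index : Type := (bool * nat * nat * nat)%type.
Local Notation raw := (cell_index -> R[i]).

Definition cell (x : raw) (b : bool) (k : nat) : nat -> nat -> R[i] :=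
  fun m j => x (b, k, m, j).

Definition cell_norm (d : bool * nat * nat) (x : raw) : R :=
  pvar d.2 (cell x d.1.1 d.1.2).

Lemma cell_normD d x y : cell_norm d (x + y) <= cell_norm d x + cell_norm d y.
Proof. exact: pvarD. Qed.

Lemma cell_normZ d c x : cell_norm d (c *: x) = normc c * cell_norm d x.
Proof. exact: pvarZ. Qed.

Lemma cell_norm_finite d : exists s : seq cell_index,
  forall x, cell_norm d x <= \sum_(i <- s) normc (x i).
Proof.
exists [seq (d.1.1, d.1.2, m, j) | m <- iota 0 d.2, j <- iota 0 d.2] => x.
rewrite big_allpairs_dep; apply: le_trans (pvar_le_sum _ _) _.
by rewrite /index_iota subn0.
Qed.

Lemma cell_norm_coord (i : cell_index) : exists d, forall x : raw, normc (x i) <= cell_norm d x.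
Proof.
case: i => [[[b k] m] j]; exists (b, k, (maxn m j).+1) => x.
by apply: (@normc_le_pvar _ _ m j (cell x b k)); rewrite ltnS leq_max leqnn ?orbT.
Qed.

(* The cell (true, k) consists of a vector y = x (true, k, 0, .) together with
   the increments x (true, k, m, .), m >= 1, of a path of bounded variation
   from 0 to (e k) y in l2; the cells (false, k), free of this constraint, make up
   the summand E. *)
Definition path_space_mem (e : nat -> R) : set raw := [set x |
  [/\ exists B, forall d, cell_norm d x <= B,
      forall eps, 0 < eps -> exists K, forall b k M, (K <= k)%N ->
        cell_norm (b, k, M) x <= eps,
      forall b k m j, (0 < m <= j)%N -> x (b, k, m, j) = 0 &
      forall k j eps, 0 < eps -> exists M0, forall M, (M0 <= M)%N ->
        normc (\sum_(1 <= m < M) x (true, k, m, j) - (e k)%:C%C * x (true, k, 0%N, j)) <= eps]].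

Section Mem.
Variable e : nat -> R.

Lemma path_space_mem0 : path_space_mem e 0.
Proof.
have c0 d : cell_norm d 0 = 0 by rewrite -(scale0r 0) cell_normZ normc0 mul0r.
split => // [|eps e0|k j eps e0]; first by exists 0 => d; rewrite c0.
  by exists 0%N => b k M _; rewrite c0 ltW.
by exists 0%N => M _; rewrite big1 // mulr0 subrr normc0 ltW.
Qed.

Lemma path_space_memD x y : path_space_mem e x -> path_space_mem e y ->
  path_space_mem e (x + y).
Proof.
move=> [[B xB] x0 xs xl] [[C yC] y0 ys yl]; split.
- by exists (B + C) => d; apply: le_trans (cell_normD _ _ _) _; rewrite lerD.
- move=> eps e0; have e2 : 0 < eps / 2 by rewrite divr_gt0.
  have [K Kx] := x0 _ e2; have [L Ly] := y0 _ e2; exists (maxn K L) => b k M.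
  rewrite geq_max => /andP[Kk Lk]; apply: le_trans (cell_normD _ _ _) _.
  by rewrite (splitr eps) lerD ?Kx ?Ly.
- by move=> b k m j mj; rewrite fctE xs // ys // addr0.
- move=> k j eps e0; have e2 : 0 < eps / 2 by rewrite divr_gt0.
  have [K Kx] := xl k j _ e2; have [L Ly] := yl k j _ e2; exists (maxn K L) => M.
  rewrite geq_max => /andP[Kk Lk]; rewrite fctE big_split mulrDr opprD addrACA.
  by apply: le_trans (le_normcD _ _) _; rewrite (splitr eps) lerD ?Kx ?Ly.
Qed.

Lemma path_space_memZ c x : path_space_mem e x -> path_space_mem e (c *: x).
Proof.
have c1 : 0 < normc c + 1 by rewrite ltr_wpDl ?normc_ge0.
have cle (u eps : R) : 0 <= u -> u <= eps / (normc c + 1) -> normc c * u <= eps.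
  move=> u0; rewrite ler_pdivlMr // mulrC; apply: le_trans.
  by rewrite ler_wpM2r // lerDl.
move=> [[B xB] x0 xs xl]; split.
- by exists (normc c * B) => d; rewrite cell_normZ ler_wpM2l ?normc_ge0.
- move=> eps e0; have [|K Kx] := x0 (eps / (normc c + 1)); first by rewrite divr_gt0.
  by exists K => b k M Kk; rewrite cell_normZ cle ?pvar_ge0 ?Kx.
- by move=> b k m j mj; rewrite fctE xs // scaler0.
- move=> k j eps e0; have [|K Kx] := xl k j (eps / (normc c + 1)); first by rewrite divr_gt0.
  exists K => M KM; rewrite fctE -mulr_sumr mulrCA -mulrBr normcM.
  by rewrite cle ?normc_ge0 ?Kx.
Qed.

Lemma path_space_bounded x : path_space_mem e x -> exists B, forall d, cell_norm d x <= B.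
Proof. by case. Qed.

Lemma path_space_closed (x : raw) : (forall eps, 0 < eps ->
  exists2 z, path_space_mem e z & forall d, cell_norm d (x - z) <= eps) ->
  path_space_mem e x.
Proof.
move=> xapp; have xle z d : cell_norm d x <= cell_norm d (x - z) + cell_norm d z.
  by rewrite -{1}[x](subrK z); exact: cell_normD.
split.
- have [z [[B zB] _ _ _] xz] := xapp 1 ltr01; exists (1 + B) => d.
  by apply: le_trans (xle z d) _; rewrite lerD.
- move=> eps e0; have e2 : 0 < eps / 2 by rewrite divr_gt0.
  have [z [_ z0 _ _] xz] := xapp _ e2; have [K Kz] := z0 _ e2; exists K => b k M Kk.
  by apply: le_trans (xle z _) _; rewrite (splitr eps) lerD ?Kz.
- move=> b k m j mj; apply/eq0_normc/eqP; rewrite eq_le normc_ge0 andbT.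
  apply/ler_addgt0Pl => eps e0; rewrite addr0.
  have [z [_ _ zs _] xz] := xapp _ e0; have [d dle] := cell_norm_coord (b, k, m, j).
  by apply: le_trans (xz d); have := dle (x - z);
  rewrite -[X in normc X]/(x (b, k, m, j) - z (b, k, m, j)) zs // subr0.
(* Replacing [x] by [z] costs one unit for the partial sum and |e k| units for the coordinate of y,
   and the constraint on [z] costs one more; 3 + |e k| leaves room for the total. *)
- move=> k j eps e0; have e3 : 0 < eps / (3%:R + `|e k|).
    by rewrite divr_gt0 // ltr_pwDl.
  have [z [_ _ _ zl] xz] := xapp _ e3; have [K Kz] := zl k j _ e3; exists K => M KM.
  set S := \sum_(1 <= m < M) _.
  pose S' := \sum_(1 <= m < M) z (true, k, m, j).
  have -> : S - (e k)%:C%C * x (true, k, 0%N, j) =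
    (S - S') + (S' - (e k)%:C%C * z (true, k, 0%N, j)) -
    (e k)%:C%C * (x (true, k, 0%N, j) - z (true, k, 0%N, j)) by ring.
  apply: le_trans (le_normcD _ _) _; rewrite normcN normcM normc_real.
  apply: (@le_trans _ _ (eps / (3%:R + `|e k|) + eps / (3%:R + `|e k|) +
     `|e k| * (eps / (3%:R + `|e k|)))); last first.
    have -> : eps = (eps / (3%:R + `|e k|)) * (3%:R + `|e k|).
      by rewrite divfK // gt_eqF // ltr_pwDl.
    rewrite mulfK ?gt_eqF ?ltr_pwDl //; lra.
  rewrite lerD //.
    apply: le_trans (le_normcD _ _) _; rewrite lerD ?Kz //.
    rewrite /S /S' -sumrB; apply: le_trans (xz (true, k, maxn M j.+1)).
    by apply: (sum_normc_le_pvar (cell (x - z) true k)); rewrite leq_max leqnn ?orbT.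
  rewrite ler_wpM2l //; apply: le_trans (xz (true, k, j.+1)).
  exact: (@normc_le_pvar _ _ 0%N j (cell (x - z) true k)).
Qed.

Definition path_family : seminormFamily R :=
  SeminormFamily (true, 0%N, 0%N) (sn := cell_norm) cell_normD cell_normZ
    cell_norm_finite cell_norm_coord path_space_mem0 path_space_memD path_space_memZ
    path_space_bounded path_space_closed.

End Mem.
End WeightedSpace.

(** * The operator space structure of the path spaces: columns and norming functionals *)

Section PathOperatorSpace.
Context {R : realType}.
Local Notation raw := (cell_index -> R[i]).

(* PathCol k: the l2-vector of the cell (true, k), as a column operator;
   PathFun b k M g: the norming functional of the cell (b, k) that pairs the m-th
   block, m < M, with g m normalized in l2. *)
Inductive path_tag := PathCol of nat | PathFun of bool & nat & nat & (nat -> nat -> R[i]).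

Definition path_fun b k M (g : nat -> nat -> R[i]) (x : raw) : R[i] :=
  \sum_(0 <= m < M) (\sum_(j <- iota 0 M) g m j * x (b, k, m, j)) /
    (l2s (iota 0 M) (g m))%:C%C.

Definition path_cs (t : path_tag) (x : raw) (i : nat) : R[i] :=
  match t with
  | PathCol k => x (true, k, 0%N, i)
  | PathFun b k M g => if i == 0%N then path_fun b k M g x else 0
  end.

Lemma path_funD b k M g x y :
  path_fun b k M g (x + y) = path_fun b k M g x + path_fun b k M g y.
Proof.
rewrite -big_split; apply: eq_bigr => m _ /=; rewrite -mulrDl -big_split.
by congr (_ / _); apply: eq_bigr => j _; exact: mulrDr.
Qed.

Lemma path_funZ b k M g c x : path_fun b k M g (c *: x) = c * path_fun b k M g x.
Proof.
rewrite mulr_sumr; apply: eq_bigr => m _; rewrite mulrA mulr_sumr.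
by congr (_ / _); apply: eq_bigr => j _; exact: mulrCA.
Qed.

Lemma path_csD t x y i : path_cs t (x + y) i = path_cs t x i + path_cs t y i.
Proof.
by case: t => [k|b k M g] //=; case: eqP => _; rewrite ?addr0 ?path_funD.
Qed.

Lemma path_csZ t c x i : path_cs t (c *: x) i = c * path_cs t x i.
Proof.
by case: t => [k|b k M g] //=; case: eqP => _; rewrite ?mulr0 ?path_funZ.
Qed.

Lemma normc_path_fun b k M g x : normc (path_fun b k M g x) <= cell_norm (b, k, M) x.
Proof.
apply: le_trans (le_normc_sum _ _) _; apply: ler_sum => m _.
rewrite normcM normcV normc_real ger0_norm ?l2s_ge0 //.
(* If [g m] vanishes on the first [M] coordinates, the inverse of 0 is 0 and the block contributes
   nothing; otherwise Cauchy-Schwarz applies. *)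
have [g0|g0] := eqVneq (l2s (iota 0 M) (g m)) 0.
  by rewrite g0 invr0 mulr0 l2s_ge0.
rewrite ler_pdivrMr ?lt_def ?g0 ?l2s_ge0 // mulrC; exact: cauchy_schwarz.
Qed.

Lemma path_cs_bounded t L :
  exists d, forall x, l2s (iota 0 L) (path_cs t x) <= cell_norm d x.
Proof.
case: t => [k|b k M g].
  exists (true, k, L.+1) => x; apply: le_trans (l2s_iota _ (leqnSn L)) _.
  exact: (l2s_le_pvar (cell x true k) (ltn0Sn L)).
exists (b, k, M) => x; apply: le_trans (normc_path_fun b k M g x).
exact: (l2s_single 0%N _ (iota_uniq 0 L)).
Qed.

(** The conjugate of [x] itself serves as [g]: in each block the normalized pairing then returns the
    l2 norm, so the functional attains [cell_norm d x]. *)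
Lemma path_cs_norming (d : bool * nat * nat) x :
  exists t L, cell_norm d x <= l2s (iota 0 L) (path_cs t x).
Proof.
case: d => [[b k] M]; pose g m j := (x (b, k, m, j))^*%C.
exists (PathFun b k M g), 1%N.
apply: le_trans (normc_le_l2s _ (mem_head 0%N [::])).
rewrite /= /path_fun (_ : \sum_(0 <= m < M) _ = (cell_norm (b, k, M) x)%:C%C).
  by rewrite normc_real ler_norm.
rewrite rmorph_sum; apply: eq_bigr => m _.
have gx : l2s (iota 0 M) (g m) = l2s (iota 0 M) (cell x b k m).
  rewrite /l2s; congr Num.sqrt; apply: eq_bigr => j _.
  by rewrite /g -[normc _]/(complex.Re (normc _)%:C%C) -normcE_norm normcJ normcE_norm.
have -> : \sum_(j <- iota 0 M) g m j * x (b, k, m, j) =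
    (l2s (iota 0 M) (cell x b k m) ^+ 2)%:C%C.
  by rewrite l2s_sqr rmorph_sum; apply: eq_bigr => j _; rewrite mulrC [RHS]sqr_normcE.
rewrite gx; have [->|g0] := eqVneq (l2s (iota 0 M) (cell x b k m)) 0.
  by rewrite expr0n mul0r.
by rewrite -[_^-1]fmorphV -rmorphM expr2 mulfK.
Qed.

Definition path_cols (e : nat -> R) : columnSystem (path_family e) :=
  @ColumnSystem R (path_family e) path_tag path_cs path_csD path_csZ
    path_cs_bounded path_cs_norming.

Definition path_space (e : nat -> R) : operatorSpace R := col_space (path_cols e).

End PathOperatorSpace.

(** * Separability *)

Section Series.
Context {R : realType}.

Lemma tail_small (u : nat -> R) (B : R) : (forall i, 0 <= u i) ->
  (forall M, \sum_(0 <= i < M) u i <= B) -> forall eps, 0 < eps ->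
  exists N, forall L M, (N <= L)%N -> \sum_(L <= i < M) u i <= eps.
Proof.
move=> u0 uB eps e0.
have hs : has_sup (range (fun M => \sum_(0 <= i < M) u i)).
  by split; [exists 0, 0%N => //; rewrite big_geq|exists B => _ [M _ <-]].
have [_ [N _ <-] Ns] := sup_adherent e0 hs; exists N => L M NL.
have [ML|LM] := leqP M L; first by rewrite big_geq // ltW.
have uM : \sum_(0 <= i < M) u i <= sup (range (fun M => \sum_(0 <= i < M) u i)).
  by apply: ub_le_sup; [case: hs|exists M].
move: uM Ns; rewrite (big_cat_nat (leq0n L) (ltnW LM)) /= (big_cat_nat (leq0n N) NL) /=.
have : 0 <= \sum_(N <= i < L) u i by apply: sumr_ge0.
by lra.
Qed.

Lemma sum_box (f : nat -> R) (c : R) L M : 0 <= c -> (forall m, f m <= c) ->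
  (forall m, (L <= m)%N -> f m <= 0) -> \sum_(0 <= m < M) f m <= L%:R * c.
Proof.
move=> c0 fc fL.
have short N : (N <= L)%N -> \sum_(0 <= m < N) f m <= L%:R * c.
  move=> NL; apply: (@le_trans _ _ (\sum_(0 <= m < N) c)); first exact: ler_sum.
  by rewrite sumr_const_nat subn0 -[leLHS]mulr_natl ler_wpM2r // ler_nat.
have [ML|LM] := leqP M L; first exact: short.
rewrite (big_cat_nat (leq0n L) (ltnW LM)) /= -[leRHS]addr0 lerD ?short //.
by rewrite big_nat_cond; apply: sumr_le0 => m /andP[/andP[/fL]].
Qed.

Lemma gaussian_rational_dense (z : R[i]) (eps : R) : 0 < eps ->
  exists p : rat * rat, normc (z - (ratr p.1 +i* ratr p.2)%C) <= eps.
Proof.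
move=> e0; have e2 : 0 < eps / 2 by rewrite divr_gt0.
have app (a : R) : exists q : rat, `|a - ratr q| <= eps / 2.
  have [|q] := @rat_in_itvoo R (a - eps / 2) (a + eps / 2).
    by rewrite ltrBlDr -addrA ltrDl addr_gt0.
  rewrite in_itv /= => /andP[aq qa]; exists q.
  by rewrite ler_distl; apply/andP; split; [rewrite lerBlDr|]; lra.
case: z => a b; have [p ap] := app a; have [q bq] := app b; exists (p, q).
apply: le_trans (normc_le_add _ _) _; rewrite (splitr eps).
exact: lerD.
Qed.

End Series.

(** The approximants [g c] may lie outside the space, as truncated rational arrays do when they
    violate the path constraint. For each c and n some member within 1/(n+1) of [g c] is chosen if
    there is one; any other such member is within 2/(n+1) of it. *)
Lemma separable_sn (R : realType) (D : seminormFamily R) (C : countType)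
    (g : C -> sn_index D -> R[i]) :
  (forall x, sn_mem (s := D) x -> forall eps, 0 < eps ->
     exists c, forall d, sn d (x - g c) <= eps) ->
  separable (sn_space D).
Proof.
move=> gdense; pose near_pt (p : C * nat) (u : sn_space D) :=
  forall d, sn d (val u - g p.1) <= p.2.+1%:R^-1.
pose f p : sn_space D :=
  if pselect (exists u, near_pt p u) is left e then projT1 (cid e) else 0.
exists (range f); first exact: (sub_countable (card_image_le _ _)).
move=> O [u Ou] Oo; have /nbhs_ballP [eps /= e0 epsO] : nbhs u O by exact: open_nbhs_nbhs.
have /complex_realP [r er] : eps \is Num.real by rewrite ger0_real // ltW.
move: e0 epsO; rewrite er ltcR => r0 rO.
have [n nr] : exists n, n.+1%:R^-1 < r / 2.
  have r2 : 0 < r / 2 by rewrite divr_gt0.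
  have [n _ h] := near_infty_natSinv_lt (PosNum r2).
  by exists n; exact: (h n (leqnn n)).
have n0 : 0 < n.+1%:R^-1 :> R by rewrite invr_gt0.
have [c uc] := gdense (val u) (sn_memP u) _ n0.
have ex : exists v, near_pt (c, n) v by exists u.
exists (f (c, n)); split; last by exists (c, n).
apply: rO; rewrite -ball_normE /= normr_sn ltcR /f.
case: pselect => [ex'|//]; case: (cid _) => v /= vc.
apply: (@le_lt_trans _ _ (n.+1%:R^-1 + n.+1%:R^-1)); last by rewrite (splitr r) ltrD.
apply: sn_norm_le => d.
rewrite -[val (u - v)]/(val u - val v) -[val u](subrK (g c)) -addrA.
apply: le_trans (snD _ _ _) _; rewrite lerD ?uc //.
by rewrite -snN opprB; exact: vc.
Qed.

Section SeparablePathSpace.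
Context {R : realType}.
Local Notation raw := (cell_index -> R[i]).

Definition cell_enum (s : seq (rat * rat)) : raw :=
  fun i => let p := nth (0, 0) s (choice.pickle (i : bool * nat * nat * nat)) in
    (ratr p.1 +i* ratr p.2)%C.

Definition in_box (L : nat) (i : (bool * nat * nat * nat)%type) : bool :=
  [&& (i.1.1.2 < L)%N, (i.1.2 < L)%N & (i.2 < L)%N].

Definition box_seq (L : nat) : seq (bool * nat * nat * nat)%type :=
  [seq (p, j) | p <- [seq (q, m) | q <- [seq (b, k) | b <- [:: true; false],
    k <- iota 0 L], m <- iota 0 L], j <- iota 0 L].

Lemma mem_box_seq L i : in_box L i -> i \in box_seq L.
Proof.
case: i => [[[b k] m] j] /and3P[/= kL mL jL].
by do 3 (apply: allpairs_f; rewrite ?mem_iota //); case: (b).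
Qed.

Definition box_trunc (L : nat) (x : raw) : raw := fun i => if in_box L i then x i else 0.

Lemma cell_enum_approx (x : raw) L eps : 0 < eps -> exists s, forall i,
  normc (box_trunc L x i - cell_enum s i) <= eps /\
  (~~ in_box L i -> cell_enum s i = 0).
Proof.
move=> e0; have r0 : (ratr 0 +i* ratr 0)%C = 0 :> R[i] by rewrite raddf0.
have /choice [q qx] : forall i, exists p : rat * rat,
    normc (x i - (ratr p.1 +i* ratr p.2)%C) <= eps.
  by move=> i; exact: gaussian_rational_dense.
pose N := (\max_(i <- box_seq L) choice.pickle i).+1.
exists (mkseq (fun n => if choice.unpickle n is Some i then
  (if in_box L i then q i else (0, 0)) else (0, 0)) N) => i.
rewrite /cell_enum /box_trunc; have [iL|iL] := boolP (in_box L i).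
  rewrite nth_mkseq ?choice.pickleK ?iL //.
  by rewrite ltnS (@leq_bigmax_seq _ _ xpredT) // mem_box_seq.
have [iN|Ni] := ltnP (choice.pickle i) N; last rewrite nth_default ?size_mkseq //.
  by rewrite nth_mkseq // choice.pickleK (negbTE iL) r0 subr0 normc0 ltW.
by rewrite r0 subr0 normc0 ltW.
Qed.

Variable e : nat -> R.

(** Block m >= 1 is supported below m, so truncation at L leaves the blocks 0 < m < L intact and
    removes the blocks m >= L, an l1 tail. Block 0 loses an l2 tail. *)
Lemma cell_trunc_tail (x : raw) b k eps : path_space_mem e x -> 0 < eps ->
  exists L0, forall L M, (L0 <= L)%N -> (k < L)%N ->
    cell_norm (b, k, M) (x - box_trunc L x) <= eps.
Proof.
move=> [[B xB] _ xs _] e0; have e2 : 0 < eps / 2 by rewrite divr_gt0.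
have B0 : 0 <= B by apply: le_trans (xB (b, k, 0%N)); exact: pvar_ge0.
pose a := cell x b k.
have a_short m M : (0 < m <= M)%N -> l2s (iota 0 M) (a m) = l2s (iota 0 m) (a m).
  move=> /andP[m0 mM]; rewrite -[M in LHS](subnKC mM) iotaD l2s_cat.
  have -> : l2s (iota (0 + m) (M - m)) (a m) = 0.
    rewrite -(l2s0 (iota (0 + m) (M - m))); apply: eq_l2s => j; rewrite mem_iota => /andP[mj _].
    by apply: xs; rewrite m0.
  by rewrite /= expr0n addr0 sqrtr_sqr ger0_norm ?l2s_ge0.
have [N1 h1] : exists N, forall L M, (N <= L)%N ->
    \sum_(L <= m < M) l2s (iota 0 m) (a m) <= eps / 2.
  apply: (@tail_small _ _ B) => // [m|M]; first exact: l2s_ge0.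
  apply: le_trans (xB (b, k, M)); rewrite /cell_norm /pvar /= !big_nat.
  by apply: ler_sum => m /andP[_ /ltnW mM]; exact: l2s_iota.
have [N2 h2] : exists N, forall L M, (N <= L)%N ->
    \sum_(L <= j < M) normc (a 0%N j) ^+ 2 <= (eps / 2) ^+ 2.
  apply: (@tail_small _ _ (B ^+ 2)) => [j|M|]; [exact: sqr_ge0| |by rewrite exprn_gt0].
  rewrite -[X in _ <= X ^+ 2]/B /index_iota subn0 -l2s_le //.
  apply: le_trans (xB (b, k, M.+1)); apply: le_trans (l2s_iota _ (leqnSn M)) _.
  exact: (l2s_le_pvar a (ltn0Sn M)).
exists (maxn N1 N2).+1 => L M; rewrite gtn_max => /andP[NL1 NL2] kL.
have trE m j : cell (x - box_trunc L x) b k m j =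
    if (m < L)%N && (j < L)%N then 0 else a m j.
  rewrite -[LHS]/(x (b, k, m, j) - box_trunc L x (b, k, m, j)) /box_trunc /in_box /= kL /=.
  by case: ifP => _; rewrite ?subrr ?subr0.
have L1 : (1 <= L)%N by apply: leq_ltn_trans NL1.
have tr0 j : (j < L)%N -> cell (x - box_trunc L x) b k 0%N j = 0.
  by move=> jL; rewrite trE L1 jL.
have [->|M0] := posnP M; first by rewrite /cell_norm /pvar /= big_geq // ltW.
rewrite /cell_norm /pvar /= big_ltn // (splitr eps) lerD //.
  rewrite (l2s_le _ _ (ltW e2)); have [ML|LM] := leqP M L.
    rewrite big_seq big1 ?sqr_ge0 // => j; rewrite mem_iota => /andP[_ jM].
    by rewrite tr0 ?normc0 ?expr0n // (leq_trans jM).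
  rewrite -[M in iota _ M](subnKC (ltnW LM)) iotaD big_cat /=.
  rewrite big_seq big1 ?add0r; last first.
    move=> j; rewrite mem_iota => /andP[_ jM].
    by rewrite tr0 ?normc0 ?expr0n.
  apply: le_trans (h2 L M (ltnW NL2)).
  rewrite add0n -/(index_iota L M) ler_sum // => j _.
  by rewrite trE; case: ifP; rewrite ?normc0 ?expr0n ?sqr_ge0.
have -> : \sum_(1 <= m < M) l2s (iota 0 M) (cell (x - box_trunc L x) b k m) =
    \sum_(1 <= m < M) (if (m < L)%N then 0 else l2s (iota 0 m) (a m)).
  rewrite !big_nat; apply: eq_bigr => m /andP[m1 mM]; case: ifP => mL.
    rewrite -(l2s0 (iota 0 M)); apply: eq_l2s => j _; rewrite trE mL /=.
    case: ltnP => // Lj; apply: xs; rewrite m1 /=; exact: leq_trans (ltnW mL) Lj.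
  have mM' : (0 < m <= M)%N by rewrite m1 ltnW.
  rewrite -(a_short _ _ mM').
  by apply: eq_l2s => j _; rewrite trE mL.
have [ML|LM] := leqP M L.
  rewrite big_nat big1 ?ltW // => m /andP[_ mM].
  by rewrite (leq_trans mM ML).
rewrite (big_cat_nat L1 (ltnW LM)) /= big_nat big1 ?add0r => [|m /andP[_ ->] //].
apply: le_trans (h1 L M (ltnW NL1)); rewrite ler_sum // => m _.
by case: ifP => // _; exact: l2s_ge0.
Qed.

Lemma path_space_approx (x : raw) eps : path_space_mem e x -> 0 < eps ->
  exists s, forall d, cell_norm d (x - cell_enum s) <= eps.
Proof.
move=> xP e0; have e2 : 0 < eps / 2 by rewrite divr_gt0.
have [_ x0 _ _] := xP; have [K0 xK0] := x0 _ e2.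
have /choice [N NP] : forall bk : (bool * nat)%type, exists L0, forall L M, (L0 <= L)%N ->
    (bk.2 < L)%N -> cell_norm (bk, M) (x - box_trunc L x) <= eps / 2.
  by move=> [b k]; exact: cell_trunc_tail.
pose L := (K0 + \max_(k < K0) maxn (N (true, k : nat)) (N (false, k : nat))).+1.
have trunc_small d : cell_norm d (x - box_trunc L x) <= eps / 2.
  case: d => [[b k] M]; have [kK|Kk] := ltnP k K0.
    apply: NP; last by rewrite ltnS /= (leq_trans (ltnW kK)) // leq_addr.
    apply: leqW; apply: leq_trans (leq_addl _ _).
    have := @leq_bigmax _ (fun k : 'I_K0 => maxn (N (true, k : nat)) (N (false, k : nat))) (Ordinal kK).
    by apply: leq_trans; case: b; rewrite ?leq_maxl ?leq_maxr.
  apply: le_trans (xK0 b k M Kk); apply: ler_sum => m _; apply: ler_l2s => j.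
  rewrite /cell -[X in normc X <= _]/(x (b, k, m, j) - box_trunc L x (b, k, m, j)).
  by rewrite /box_trunc; case: ifP; rewrite ?subrr ?subr0 ?normc0 ?normc_ge0.
(* Each cell meets the box in L^2 entries, and the norm of a cell is at most the sum of the moduli
   of its entries. *)
have eL : 0 < eps / 2 / (L * L)%:R by rewrite !divr_gt0.
have [s sP] := cell_enum_approx x L eL; exists s => d.
have -> : x - cell_enum s = (x - box_trunc L x) + (box_trunc L x - cell_enum s).
  by rewrite addrA subrK.
apply: le_trans (cell_normD _ _ _) _; rewrite (splitr eps) lerD //.
case: d => [[b k] M]; apply: le_trans (pvar_le_sum _ _) _.
have -> : eps / 2 = L%:R * (L%:R * (eps / 2 / (L * L)%:R)).
  by rewrite natrM; field; rewrite pnatr_eq0.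
have out m j : ~~ in_box L (b, k, m, j) ->
    normc (cell (box_trunc L x - cell_enum s) b k m j) <= 0.
  move=> out; rewrite /cell -[X in normc X <= _]/(box_trunc L x (b, k, m, j) - cell_enum s (b, k, m, j)).
  by rewrite /box_trunc (negbTE out) (sP _).2 // subrr normc0.
have le m j : normc (cell (box_trunc L x - cell_enum s) b k m j) <= eps / 2 / (L * L)%:R.
  exact: (sP (b, k, m, j)).1.
apply: sum_box => [|m|m Lm]; first by rewrite mulr_ge0 // ltW.
  apply: sum_box => [|j|j Lj]; [exact: ltW|exact: le|apply: out].
  by rewrite /in_box /= (ltnNge j) Lj !andbF.
by apply: sumr_le0 => j _; apply: out; rewrite /in_box /= (ltnNge m) Lm andbF.
Qed.

Lemma separable_path_space : separable (path_space e).
Proof.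
by apply: (@separable_sn R (path_family e) _ cell_enum) => x xP eps e0; exact: path_space_approx.
Qed.

End SeparablePathSpace.

(** * The isomorphic embedding *)

Section Shift.
Context {R : realType}.
Local Notation raw := (cell_index -> R[i]).

Definition weightY (k : nat) : R := k.+1%:R^-1.
Definition weightX (k : nat) : R := if k is k'.+1 then weightY k' else 0.

(** The cell of X from which a given cell of Y is filled. All cells carry the same norm, so this
    relabelling is isometric. The cells (true, k.+1) of X keep their constraint because
    [weightX k.+1] is [weightY k]; the cell (true, 0) loses it on entering (false, 0). *)
Definition shift_cell (b : bool) (k : nat) : bool * nat :=
  if b then (true, k.+1) else if k is k'.+1 then (false, k') else (true, 0%N).

Definition shift (x : raw) : raw :=
  fun i => x (shift_cell i.1.1.1 i.1.1.2, i.1.2, i.2).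

Lemma shift_norm b k M x : cell_norm (b, k, M) (shift x) = cell_norm (shift_cell b k, M) x.
Proof. by case: b; case: k. Qed.

Lemma shift_cell_surj c : exists b k, shift_cell b k = c.
Proof.
case: c => [[] k]; last by exists false, k.+1.
by case: k => [|k]; [exists false, 0%N|exists true, k].
Qed.

Lemma shift_mem x : path_space_mem weightX x -> path_space_mem weightY (shift x).
Proof.
move=> [[B xB] x0 xs xl]; split.
- by exists B => -[[b k] M]; rewrite shift_norm.
- move=> eps /x0 [K Kx]; exists K.+1 => b k M Kk; rewrite shift_norm.
  have := Kx (shift_cell b k).1 (shift_cell b k).2 M; rewrite -surjective_pairing; apply.
  by case: b k Kk => -[|k] //= Kk; lia.
- by move=> b k m j mj; rewrite /shift /= (surjective_pairing (shift_cell b k)) xs.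
- by move=> k; exact: xl k.+1.
Qed.

Definition shift_emb (u : sn_space (path_family weightX)) : sn_space (path_family weightY) :=
  sn_mk (D := path_family weightY) (shift_mem (sn_memP u)).

Lemma shift_emb_linear : linear shift_emb.
Proof. by move=> c u v; exact/val_inj. Qed.

HB.instance Definition _ := GRing.isLinear.Build R[i] _ _ _ shift_emb shift_emb_linear.

Lemma vnorm_shift u : vnorm (shift_emb u) = vnorm u.
Proof.
rewrite !vnorm_sn; apply/eqP; rewrite eq_le; apply/andP; split.
  apply: sn_norm_le => -[[b k] M]; apply: le_trans (sn_le_norm u (shift_cell b k, M)).
  by rewrite [leLHS]shift_norm.
apply: sn_norm_le => -[c M]; have [b [k <-]] := shift_cell_surj c.
apply: le_trans (sn_le_norm (shift_emb u) (b, k, M)).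
by rewrite [leRHS]shift_norm.
Qed.

Lemma isomorphically_embeds_path_space :
  isomorphically_embeds (path_space weightX) (path_space weightY).
Proof.
exists shift_emb; split.
- move=> u v /(congr1 (fun w => vnorm (w - shift_emb v))).
  rewrite subrr vnorm0 -raddfB vnorm_shift => uv; apply/subr0_eq/eqP.
  by rewrite -normr_eq0 vnormC uv.
- apply: (@le_lt_trans _ _ 1%:E); last exact: ltry.
  by apply: ge_ereal_sup => _ [u /= u1 <-]; rewrite lee_fin vnorm_shift.
- apply: (@le_lt_trans _ _ 1%:E); last exact: ltry.
  by apply: ge_ereal_sup => _ [u /= u1 <-]; rewrite lee_fin -vnorm_shift.
Qed.

End Shift.

(** * Nonlinear lifting of vectors to paths *)

Section PathLift.
Context {R : realType}.
Implicit Types (y : nat -> R[i]) (k m j M : nat).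

Definition ell2_bounded y := exists B, forall M, l2s (iota 0 M) y <= B.

Definition tail k y : nat -> R[i] := fun j => if (j < k)%N then 0 else y j.

Definition tail_norm y k : R := sup (range (fun M => l2s (iota 0 M) (tail k y))).

Lemma l2s_tail k y M : l2s (iota 0 M) (tail k y) <= l2s (iota 0 M) y.
Proof.
by apply: ler_l2s => j; rewrite /tail; case: ifP => // _; rewrite normc0 normc_ge0.
Qed.

Section Bounded.
Variables (y : nat -> R[i]) (yb : ell2_bounded y).

Lemma tail_has_sup k : has_sup (range (fun M => l2s (iota 0 M) (tail k y))).
Proof.
split; first by exists (l2s (iota 0 0) (tail k y)), 0%N.
by have [B yB] := yb; exists B => _ [M _ <-]; apply: le_trans (l2s_tail _ _ _) (yB M).
Qed.

Lemma l2s_le_tail_norm k M : l2s (iota 0 M) (tail k y) <= tail_norm y k.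
Proof. by apply: ub_le_sup; [case: (tail_has_sup k)|exists M]. Qed.

Lemma tail_norm_le k B : (forall M, l2s (iota 0 M) (tail k y) <= B) -> tail_norm y k <= B.
Proof. by move=> yB; apply: ge_sup; [case: (tail_has_sup k)|move=> _ [M _ <-]]. Qed.

Lemma tail_norm_ge0 k : 0 <= tail_norm y k.
Proof. by apply: le_trans (l2s_le_tail_norm k 0); exact: l2s_ge0. Qed.

Lemma tail_norm_mono k k' : (k <= k')%N -> tail_norm y k' <= tail_norm y k.
Proof.
move=> kk'; apply: tail_norm_le => M; apply: le_trans (l2s_le_tail_norm k M).
apply: ler_l2s => j; rewrite /tail; case: (ltnP j k') => [_|kj].
  by rewrite normc0 normc_ge0.
by rewrite ltnNge (leq_trans kk' kj).
Qed.

Lemma normc_tail k j : normc (tail k y j) <= tail_norm y k.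
Proof.
apply: le_trans (l2s_le_tail_norm k j.+1); apply: normc_le_l2s.
by rewrite mem_iota add0n ltnSn.
Qed.

Lemma tail_norm_cvg0 eps : 0 < eps -> exists N, tail_norm y N <= eps.
Proof.
move=> e0; have [B yB] := yb.
have [N NP] : exists N, forall L M, (N <= L)%N ->
    \sum_(L <= j < M) normc (y j) ^+ 2 <= eps ^+ 2.
  apply: (@tail_small _ _ (B ^+ 2)) => [j|M|]; [exact: sqr_ge0| |by rewrite exprn_gt0].
  have B0 : 0 <= B by apply: le_trans (yB 0%N); exact: l2s_ge0.
  by rewrite /index_iota subn0 -l2s_le.
exists N; apply: tail_norm_le => M; rewrite (l2s_le _ _ (ltW e0)).
have [MN|NM] := leqP M N.
  rewrite big_seq big1 ?sqr_ge0 // => j; rewrite mem_iota => /andP[_ jM].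
  by rewrite /tail (leq_trans jM MN) normc0 expr0n.
rewrite -[M](subnKC (ltnW NM)) iotaD big_cat /= big_seq big1 ?add0r; last first.
  by move=> j; rewrite mem_iota => /andP[_ jM]; rewrite /tail jM normc0 expr0n.
apply: le_trans (NP N M (leqnn N)); rewrite -/(index_iota N M) ler_sum // => j _.
by rewrite /tail; case: ifP; rewrite ?normc0 ?expr0n ?sqr_ge0.
Qed.

End Bounded.

(* The greedy path m |-> P_(lift_time y m) y of truncations of y: it moves only when
   this halves the distance to y, so that a move costs at most twice the decrease
   of the distance and the variation telescopes to at most 2 |y|. *)
Fixpoint lift_time y m : nat :=
  if m is m'.+1 then
    if tail_norm y m <= tail_norm y (lift_time y m') / 2 then m else lift_time y m'
  else 0.

(** The m-th increment of the greedy path. It is supported below m, as the path space demands,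
    because a move at step m goes exactly to time m. *)
Definition path_lift y m j : R[i] :=
  if m is m'.+1 then
    if (lift_time y m' <= j < lift_time y m)%N then y j else 0
  else 0.

Lemma lift_time_le y m : (lift_time y m <= m)%N.
Proof. by elim: m => //= m IH; case: ifP => // _; rewrite leqW. Qed.

Lemma lift_time_mono y m : (lift_time y m <= lift_time y m.+1)%N.
Proof. by rewrite /=; case: ifP => // _; rewrite leqW ?lift_time_le. Qed.

Lemma path_lift_supp y m j : (0 < m <= j)%N -> path_lift y m j = 0.
Proof.
case: m => // m /= mj; case: ifP => // /andP[_]; rewrite ltnNge.
by rewrite (leq_trans (lift_time_le y m.+1) mj).
Qed.

Lemma sum_path_lift y M j :
  \sum_(1 <= m < M.+1) path_lift y m j = y j - tail (lift_time y M) y j.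
Proof.
elim: M => [|M IH]; first by rewrite big_geq // /tail /= subrr.
rewrite big_nat_recr //= {}IH -/(lift_time y M.+1) /tail.
have := lift_time_mono y M; case: (ltnP j (lift_time y M)) => [jM|Mj] MM.
  by rewrite (leq_trans jM MM) !subr0 addr0.
by case: (j < lift_time y M.+1)%N; rewrite ?andbT ?andbF subrr ?add0r ?subr0.
Qed.

Lemma pvar_path_lift y M : ell2_bounded y -> pvar M (path_lift y) <= 2 * tail_norm y 0.
Proof.
move=> yb; have D0 := tail_norm_ge0 yb.
have [->|M0] := posnP M; first by rewrite /pvar big_geq // mulr_ge0.
suff H N : (0 < N)%N -> \sum_(0 <= m < N) l2s (iota 0 M) (path_lift y m) <=
    2 * (tail_norm y 0 - tail_norm y (lift_time y N.-1)).
  by apply: le_trans (H M M0) _; rewrite ler_pM2l // gerBl.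
elim: N => // -[_ _|N IH _].
  have lift0 : path_lift y 0 = 0 by [].
  by rewrite big_nat1 lift0 l2s0 /= subrr mulr0.
rewrite big_nat_recr //=; have := IH isT => /= {}IH.
have step : l2s (iota 0 M) (path_lift y N.+1) <=
    2 * (tail_norm y (lift_time y N) - tail_norm y (lift_time y N.+1)).
  have [half|nhalf] := boolP (tail_norm y N.+1 <= tail_norm y (lift_time y N) / 2); last first.
    have stay : lift_time y N.+1 = lift_time y N by rewrite /= (negbTE nhalf).
    rewrite stay subrr mulr0 (_ : path_lift y N.+1 = 0) ?l2s0 //.
    by apply/funext => j; rewrite /path_lift stay ltnNge andbN.
  have moved : lift_time y N.+1 = N.+1 by rewrite /= half.
  rewrite moved.
  apply: (@le_trans _ _ (tail_norm y (lift_time y N))).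
    apply: le_trans (l2s_le_tail_norm yb _ M); apply: ler_l2s => j.
    rewrite /path_lift /tail leqNgt; case: (j < lift_time y N)%N.
      by rewrite normc0.
    by case: ifP; rewrite ?normc0 ?normc_ge0.
  by lra.
by apply: le_trans (lerD IH step) _; rewrite -mulrDr ler_pM2l // addrA subrK.
Qed.

Lemma path_lift_cvg y j eps : ell2_bounded y -> 0 < eps -> exists M0, forall M, (M0 <= M)%N ->
  normc (\sum_(1 <= m < M) path_lift y m j - y j) <= eps.
Proof.
move=> yb e0; have e2 : 0 < eps / 2 by rewrite divr_gt0.
have [N yN] := tail_norm_cvg0 yb e2.
(* If the path is still further than [eps] from [y] at step N, then the tail at N+1, being at most
   eps / 2, is below half of that distance, and the path moves there. *)
have [m ym] : exists m, tail_norm y (lift_time y m) <= eps.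
  have [yN'|yN'] := leP (tail_norm y (lift_time y N)) eps; first by exists N.
  exists N.+1 => /=; have NN := tail_norm_mono yb (leqnSn N).
  case: ifP => [_|/negbT]; first by lra.
  by rewrite -ltNge; lra.
have tmono i i' : (i <= i')%N -> (lift_time y i <= lift_time y i')%N.
  by apply: (@homo_leq _ _ leq leqnn leq_trans); exact: lift_time_mono.
exists m.+1 => -[//|M] mM; rewrite sum_path_lift addrAC subrr add0r normcN.
apply: le_trans (normc_tail yb _ _) _; apply: le_trans ym.
exact/tail_norm_mono/tmono.
Qed.

End PathLift.

(** * The nonlinear change of weights *)

Section Twist.
Context {R : realType}.
Local Notation raw := (cell_index -> R[i]).
Implicit Types (e : nat -> R) (x : raw) (rel : nat -> nat).

Definition cell_vec x k : nat -> R[i] := cell x true k 0.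

Definition reindex_cells rel x : raw :=
  fun i => if i.1.1.1 then x (true, rel i.1.1.2, i.1.2, i.2) else x i.

Definition twist_part e e' rel x : raw :=
  fun i => if i.1.1.1 then
    (e' i.1.1.2 - e (rel i.1.1.2))%:C%C *
      path_lift (cell_vec x (rel i.1.1.2)) i.1.2 i.2 else 0.

(** The cell (true, k) is filled from (true, rel k). Its y is carried over unchanged, since
    [path_lift] vanishes at m = 0; only the path is corrected. *)
Definition twist e e' rel x : raw := reindex_cells rel x + twist_part e e' rel x.

Lemma cell_vec_bounded x k : (exists B, forall d, cell_norm d x <= B) ->
  ell2_bounded (cell_vec x k).
Proof.
move=> [B xB]; exists B => M; apply: le_trans (xB (true, k, M.+1)).
apply: le_trans (l2s_iota _ (leqnSn M)) _.
exact: (l2s_le_pvar (cell x true k) (ltn0Sn M)).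
Qed.

Lemma tail_norm_cell_vec x k c : (exists B, forall d, cell_norm d x <= B) ->
  (forall M, cell_norm (true, k, M) x <= c) -> tail_norm (cell_vec x k) 0 <= c.
Proof.
move=> xb xc; apply: (tail_norm_le (cell_vec_bounded k xb)) => M.
apply: le_trans (l2s_tail _ _ _) _; apply: le_trans (xc M.+1).
apply: le_trans (l2s_iota _ (leqnSn M)) _.
exact: (l2s_le_pvar (cell x true k) (ltn0Sn M)).
Qed.

Lemma cell_norm_reindex rel b k M x :
  cell_norm (b, k, M) (reindex_cells rel x) = cell_norm (b, if b then rel k else k, M) x.
Proof. by case: b. Qed.

Lemma cell_norm_twist_part e e' rel eta b k M x c :
  (forall k, `|e' k - e (rel k)| <= eta) ->
  (exists B, forall d, cell_norm d x <= B) ->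
  (forall M, cell_norm (b, if b then rel k else k, M) x <= c) ->
  cell_norm (b, k, M) (twist_part e e' rel x) <= eta * (2 * c).
Proof.
move=> eeta xb xc; have eta0 : 0 <= eta by apply: le_trans (eeta 0%N).
have c0 : 0 <= c by apply: le_trans (xc 0%N); exact: pvar_ge0.
case: b xc => xc; last first.
  rewrite (_ : cell_norm _ _ = cell_norm (false, k, M) (0 : raw)) //.
  by rewrite -(scale0r 0) cell_normZ normc0 mul0r !mulr_ge0.
apply: (@le_trans _ _ (normc (e' k - e (rel k))%:C%C *
    pvar M (path_lift (cell_vec x (rel k))))).
  by rewrite -pvarZ.
rewrite normc_real ler_pM ?pvar_ge0 //.
apply: le_trans (pvar_path_lift _ (cell_vec_bounded (rel k) xb)) _.
by rewrite ler_pM2l // tail_norm_cell_vec.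
Qed.

(** The lift tends to y, so the corrected path tends to (e (rel k) + (e' k - e (rel k))) y = e' k y.
    The cell k is controlled by the cell [rel k] of [x], hence the c0 condition survives when [rel]
    tends to infinity. *)
Lemma twist_mem e e' rel eta x : (forall k, `|e' k - e (rel k)| <= eta) ->
  (forall K, exists K', forall k, (K' <= k)%N -> (K <= rel k)%N) ->
  path_space_mem e x -> path_space_mem e' (twist e e' rel x).
Proof.
move=> eeta relK [xb x0 xs xl]; have eta0 : 0 <= eta by apply: le_trans (eeta 0%N).
have twist_le b k M c : (forall M, cell_norm (b, if b then rel k else k, M) x <= c) ->
    cell_norm (b, k, M) (twist e e' rel x) <= c + eta * (2 * c).
  move=> xc; apply: le_trans (cell_normD _ _ _) _; rewrite lerD //.
    by rewrite cell_norm_reindex.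
  exact: cell_norm_twist_part.
split.
- have [B xB] := xb; exists (B + eta * (2 * B)) => -[[b k] M].
  by apply: twist_le => M'; exact: xB.
- move=> eps e0; have c0 : 0 < eps / (1 + 2 * eta).
    by rewrite divr_gt0 // ltr_pwDl // mulr_ge0.
  have [K Kx] := x0 _ c0; have [K' KK'] := relK K.
  exists (maxn K K') => b k M; rewrite geq_max => /andP[Kk K'k].
  have -> : eps = eps / (1 + 2 * eta) + eta * (2 * (eps / (1 + 2 * eta))).
    by field; rewrite gt_eqF // ltr_pwDl // mulr_ge0.
  by apply: twist_le => M'; apply: Kx; case: b => //; exact: KK'.
- move=> b k m j mj; rewrite /twist -[LHS]/(reindex_cells rel x (b, k, m, j) +
    twist_part e e' rel x (b, k, m, j)) /reindex_cells /twist_part /=.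
  by case: b; rewrite xs // ?path_lift_supp // ?mulr0 addr0.
- move=> k j eps e0; have e2 : 0 < eps / 2 by rewrite divr_gt0.
  set dk := e' k - e (rel k).
  have d1 : 0 < `|dk| + 1 by rewrite ltr_wpDl.
  have [K Kx] := xl (rel k) j _ e2.
  have [|L Ly] := @path_lift_cvg _ (cell_vec x (rel k)) j (eps / 2 / (`|dk| + 1))
    (cell_vec_bounded (rel k) xb); first by rewrite divr_gt0.
  exists (maxn K L) => M; rewrite geq_max => /andP[/Kx KM /Ly LM].
  have -> : \sum_(1 <= m < M) twist e e' rel x (true, k, m, j) =
      \sum_(1 <= m < M) x (true, rel k, m, j) +
      dk%:C%C * \sum_(1 <= m < M) path_lift (cell_vec x (rel k)) m j.
    by rewrite mulr_sumr -big_split.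
  have -> : twist e e' rel x (true, k, 0%N, j) = x (true, rel k, 0%N, j).
    by rewrite -[RHS]addr0; congr (_ + _); exact: mulr0.
  set S := \sum_(1 <= m < M) x _; set T := \sum_(1 <= m < M) _.
  have -> : (e' k)%:C%C = (e (rel k))%:C%C + dk%:C%C by rewrite -rmorphD /dk subrKC.
  have -> : S + dk%:C%C * T - ((e (rel k))%:C%C + dk%:C%C) * x (true, rel k, 0%N, j) =
    (S - (e (rel k))%:C%C * x (true, rel k, 0%N, j)) +
    dk%:C%C * (T - cell_vec x (rel k) j) by rewrite /cell_vec /cell; ring.
  apply: le_trans (le_normcD _ _) _; rewrite (splitr eps) lerD //.
  rewrite normcM normc_real; apply: (@le_trans _ _ ((`|dk| + 1) * (eps / 2 / (`|dk| + 1)))).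
    by rewrite ler_pM ?normc_ge0 // lerDl.
  by rewrite mulrC divfK // gt_eqF.
Qed.

(** Both twists see the same y, hence the same lifted path, which enters with opposite coefficients
    and cancels, although the lifting is not linear. *)
Lemma twistK e e' rel rel' x : cancel rel rel' -> cancel rel' rel ->
  twist e' e rel' (twist e e' rel x) = x.
Proof.
move=> relK relK'; have vecE k : cell_vec (twist e e' rel x) (rel' k) = cell_vec x k.
  apply/funext => j; rewrite /cell_vec /cell -[RHS]addr0 -{2}(relK' k).
  by congr (_ + _); exact: mulr0.
apply/funext => -[[[b k] m] j]; rewrite -[LHS]/(reindex_cells rel' (twist e e' rel x) (b, k, m, j) +
    twist_part e' e rel' (twist e e' rel x) (b, k, m, j)).
case: b; rewrite /reindex_cells /twist_part /=; last first.
  by rewrite addr0 -[RHS]addr0.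
rewrite vecE -[X in X + _]/(x (true, rel (rel' k), m, j) +
  (e' (rel' k) - e (rel (rel' k)))%:C%C * path_lift (cell_vec x (rel (rel' k))) m j).
have d0 : (e' (rel' k) - e k)%:C%C + (e k - e' (rel' k))%:C%C = 0 :> R[i].
  by rewrite -rmorphD addrA subrK subrr rmorph0.
by rewrite relK' -addrA -mulrDl d0 mul0r addr0.
Qed.

Definition reindex_tag rel (t : @path_tag R) : path_tag :=
  match t with
  | PathCol k => PathCol (rel k)
  | PathFun b k M g => PathFun b (if b then rel k else k) M g
  end.

Lemma path_cs_reindex rel t x i :
  path_cs t (reindex_cells rel x) i = path_cs (reindex_tag rel t) x i.
Proof. by case: t => [k|[] k M g]. Qed.

(** Relabelling the cells of the vectors amounts to relabelling the tags, so it cannot increase a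
    matrix norm, whatever the weights are. *)
Lemma col_le_reindex e e' rel n B (x : 'I_n -> 'I_n -> raw) :
  @col_le R _ (path_cols e) n B x ->
  @col_le R _ (path_cols e') n B (fun a b => reindex_cells rel (x a b)).
Proof.
move=> xB t L xi; apply: le_trans (xB (reindex_tag rel t) L xi).
rewrite le_eqVlt; apply/orP; left; apply/eqP.
apply: eq_bigr => a _; apply: eq_bigr => i _; congr (normc _ ^+ 2).
by apply: eq_bigr => b _; congr (_ * _); exact: path_cs_reindex.
Qed.

End Twist.

(** * Matrix estimates for the twist and the coarse equivalence *)

Section CoarseEquivalence.
Context {R : realType}.
Local Notation raw := (cell_index -> R[i]).

Definition close_weights (e e' : nat -> R) (rel : nat -> nat) (eta : R) : Prop :=
  (forall k, `|e' k - e (rel k)| <= eta) /\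
  (forall K, exists K', forall k, (K' <= k)%N -> (K <= rel k)%N).

Definition twist_map e e' rel eta (H : close_weights e e' rel eta)
    (u : sn_space (path_family e)) : sn_space (path_family e') :=
  sn_mk (D := path_family e') (twist_mem H.1 H.2 (sn_memP u)).

Lemma twist_mapK e e' rel rel' eta (H : close_weights e e' rel eta)
    (H' : close_weights e' e rel' eta) : cancel rel rel' -> cancel rel' rel ->
  cancel (twist_map H) (twist_map H').
Proof. by move=> relK relK' u; apply/val_inj; exact: twistK. Qed.

Lemma col_le_mono (D : seminormFamily R) (W : columnSystem D) n B C
    (x : 'I_n -> 'I_n -> sn_index D -> R[i]) : 0 <= B -> B <= C ->
  @col_le R D W n B x -> @col_le R D W n C x.
Proof.
move=> B0 BC xB t L xi; apply: le_trans (xB t L xi) _.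
rewrite ler_wpM2r //; first by apply: sumr_ge0 => b _; exact: sqr_ge0.
by rewrite ler_pXn2r ?nnegrE // (le_trans B0).
Qed.

Section Estimate.
Variables (e e' : nat -> R) (rel rel' : nat -> nat) (eta : R) (n : nat).
Hypothesis relK' : cancel rel' rel.
Hypotheses (H : close_weights e e' rel eta) (small : 4 * n%:R ^+ 3 * eta <= 1).
Variables (x z : 'M[path_space e]_n).
Hypotheses (xn : mxball x) (zn : mxball z).
Local Notation F := (twist_map H).

Let part a b : raw := twist_part e e' rel (raw_mx x a b) - twist_part e e' rel (raw_mx z a b).

(** Origin of 4 n^3: every entry has norm at most n, the lift doubles it at most, the parts of [x]
    and [z] are bounded separately because the lifting is only known to be bounded, and passing from
    entries to the matrix costs n^2. *)
Lemma twist_part_small : @col_le R _ (path_cols e') n 1 part.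
Proof.
have eta0 : 0 <= eta by apply: le_trans (H.1 0%N).
have part_le (w : 'M[path_space e]_n) a b d : mxball w ->
    cell_norm d (twist_part e e' rel (raw_mx w a b)) <= eta * (2 * n%:R).
  case: d => [[c k] M] wn; apply: cell_norm_twist_part H.1 _ _.
    by exists (mxnorm w) => d; exact: (sn_raw_mx w a b d).
  by move=> M'; apply: le_trans wn; exact: (sn_raw_mx w a b (_, _, M')).
apply: (@col_le_mono _ _ _ ((n ^ 2)%:R * (eta * (2 * n%:R) + eta * (2 * n%:R)))).
- by rewrite mulr_ge0 // addr_ge0 ?mulr_ge0.
- by rewrite natrX; apply: le_trans small; lra.
apply: col_le_entries => a b d; apply: le_trans (snB _ _ _) _.
by apply: lerD; [exact: part_le xn|exact: part_le zn].
Qed.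

Lemma raw_mx_twist a b :
  raw_mx (map_mx F x - map_mx F z : 'M[path_space e']_n) a b =
  reindex_cells rel (raw_mx (x - z) a b) + part a b.
Proof.
rewrite /raw_mx /part !mxE -[LHS]/(twist e e' rel _ - twist e e' rel _).
rewrite /twist opprD addrACA; congr (_ + _).
by apply/funext => -[[[[] k] m] j].
Qed.

Lemma mxdist_twist :
  mxdist (map_mx F x : 'M[path_space e']_n) (map_mx F z) <= mxdist x z + 1.
Proof.
apply: mxnorm_le; first by rewrite addr_ge0 ?mxnorm_ge0.
apply: eq_col_le (fun a b => esym (raw_mx_twist a b)) _.
apply: col_leD (mxnorm_ge0 _) ler01 _ twist_part_small.
exact/col_le_reindex/col_le_mxnorm.
Qed.

(** Removing the small part from the difference of the images leaves the relabelled difference, and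
    relabelling back through [rel'] recovers [x - z]. *)
Lemma mxdist_twist_ge :
  mxdist x z <= mxdist (map_mx F x : 'M[path_space e']_n) (map_mx F z) + 1.
Proof.
apply: mxnorm_le; first by rewrite addr_ge0 ?mxnorm_ge0.
pose y a b := raw_mx (map_mx F x - map_mx F z : 'M[path_space e']_n) a b + - part a b.
apply: (@eq_col_le R (path_family e) (path_cols e) n _ (fun a b => reindex_cells rel' (y a b))) => [a b|].
  rewrite /y raw_mx_twist addrK; apply/funext => -[[[c k] m] j].
  by case: c; rewrite // /reindex_cells /= relK'.
apply: (@col_le_reindex _ e').
by apply: col_leD (mxnorm_ge0 _) ler01 (col_le_mxnorm _) (col_leN twist_part_small).
Qed.

End Estimate.

Lemma equi_coarse_twist (e e' : nat -> R) (rel rel' : nat -> nat -> nat) (eta : nat -> R)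
    (H : forall n, close_weights e e' (rel n) (eta n)) :
  (forall n, cancel (rel' n) (rel n)) -> (forall n, 4 * n%:R ^+ 3 * eta n <= 1) ->
  @equi_coarse R (fun n => 'M[path_space e]_n) (fun n => 'M[path_space e']_n)
    (fun n => mxdist) (fun n => mxdist) (@mxball R (path_space e))
    (fun n => map_mx (twist_map (H n))).
Proof.
(* Distances change by at most 1, in either direction, so the same s serves both implications and
   every n. *)
move=> relK' small r r0; exists (r + 1); first by rewrite addr_gt0.
move=> n n0 x z xn zn; split=> [xz|].
  by apply: le_trans (mxdist_twist (H n) (small n) xn zn) _; rewrite lerD2r.
move=> rxz; rewrite -(lerD2r 1); apply: le_trans rxz _.
exact: (mxdist_twist_ge (relK' n) (H n) (small n) xn zn).
Qed.

Definition cycle_up (K k : nat) : nat :=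
  if k == K then 0 else if (k < K)%N then k.+1 else k.

Definition cycle_down (K k : nat) : nat :=
  if k == 0 then K else if (k <= K)%N then k.-1 else k.

Lemma cycle_upK K : cancel (cycle_up K) (cycle_down K).
Proof. by move=> k; rewrite /cycle_up /cycle_down; do !case: ifP => //=; lia. Qed.

Lemma cycle_downK K : cancel (cycle_down K) (cycle_up K).
Proof. by move=> k; rewrite /cycle_up /cycle_down; do !case: ifP => //=; lia. Qed.

Lemma weightY_le K k : (K <= k)%N -> 0 <= @weightY R k <= weightY K.
Proof. by move=> Kk; rewrite /weightY invr_ge0 ler0n /= lef_pV2 ?posrE // ler_nat. Qed.

(** Below K the shift by one makes the weights equal. The cell K of Y is filled from the cell of
    weight 0, at cost [weightY K]. Above K nothing is moved, and both weights lie between 0 and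
    [weightY K]. *)
Lemma weights_cycle_up K k : `|weightY k - weightX (cycle_up K k)| <= weightY K :> R.
Proof.
have [K0 _] := andP (weightY_le (leqnn K)).
rewrite /cycle_up; case: eqP => [->|/eqP kK] /=; first by rewrite subr0 ger0_norm.
case: ltnP => [_|Kk] /=; first by rewrite subrr normr0.
case: k kK Kk => [|k] kK Kk; first by lia.
have /andP[k1 k2] := weightY_le Kk.
have /andP[k3 k4] : 0 <= @weightY R k <= weightY K by apply: weightY_le; lia.
by rewrite ler_norml /=; lra.
Qed.

Lemma close_up K : close_weights (@weightX R) weightY (cycle_up K) (weightY K).
Proof.
split=> [k|L]; first exact: weights_cycle_up.
by exists (L + K).+1 => k Lk; rewrite /cycle_up; do !case: ifP => //=; lia.
Qed.

Lemma close_down K : close_weights (@weightY R) weightX (cycle_down K) (weightY K).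
Proof.
split=> [k|L]; first by have := weights_cycle_up K (cycle_down K k); rewrite cycle_downK distrC.
by exists (L + K).+1 => k Lk; rewrite /cycle_down; do !case: ifP => //=; lia.
Qed.

Lemma coarsely_equivalent_path_space :
  bounded_subsets_almost_completely_coarsely_equivalent
    (path_space (@weightX R)) (path_space (@weightY R)).
Proof.
pose K n := (4 * n ^ 3)%N.
have small n : 4 * n%:R ^+ 3 * weightY (K n) <= 1 :> R.
  by rewrite /weightY ler_pdivrMr // mul1r -natrX -natrM ler_nat.
exists (fun n => twist_map (close_up (K n))), (fun n => twist_map (close_down (K n))).
split.
- move=> n _; split; apply: twist_mapK.
  + exact: cycle_upK. + exact: cycle_downK. + exact: cycle_downK. + exact: cycle_upK.
- by apply: equi_coarse_twist => n; [exact: cycle_downK|].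
- by apply: equi_coarse_twist => n; [exact: cycle_upK|].
Qed.

End CoarseEquivalence.

(** * Failure of almost complete embedding *)

Arguments normc : simpl never.

Section UnitVectors.
Context {R : realType}.
Local Notation raw := (cell_index -> R[i]).
Local Notation X := (sn_space (path_family (@weightX R))).

Definition unit_raw (i : nat) : raw := fun c =>
  if [&& c.1.1.1, c.1.1.2 == 0%N, c.1.2 == 0%N & c.2 == i] then 1 else 0.

Lemma cell_norm_unit b k M i : cell_norm (b, k, M) (unit_raw i) <= (k == 0%N)%:R.
Proof.
have [->|M0] := posnP M; first by rewrite /cell_norm /pvar big_geq.
rewrite /cell_norm /pvar /= big_ltn // big_nat big1 ?addr0; last first.
  move=> m /andP[m0 _]; rewrite -(l2s0 (iota 0 M)); apply: eq_l2s => j _.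
  by rewrite /cell /unit_raw /= (gtn_eqF m0) !andbF.
rewrite (@eq_l2s _ _ _ _ (fun j => if j == i then (if b && (k == 0%N) then 1 else 0) else 0)).
  apply: le_trans (l2s_single i _ (iota_uniq 0 M)) _.
  by case: ifP => [/andP[_ ->]|_]; rewrite ?normc1 ?normc0 ?ler0n.
move=> j _; rewrite /cell /unit_raw /=.
by case: b; case: (k == 0%N); case: (j == i).
Qed.

(** The weight of the cell (true, 0) of X is 0, so there the zero path may accompany any y. *)
Lemma unit_mem i : path_space_mem weightX (unit_raw i).
Proof.
split.
- exists 1 => -[[b k] M]; apply: le_trans (cell_norm_unit _ _ _ _) _.
  by rewrite lern1 leq_b1.
- move=> eps e0; exists 1%N => b k M k1; apply: le_trans (cell_norm_unit _ _ _ _) _.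
  by rewrite (gtn_eqF k1) ltW.
- by move=> b k m j /andP[m0 _]; rewrite /unit_raw /= (gtn_eqF m0) !andbF.
- move=> k j eps e0; exists 0%N => M _; rewrite big_nat big1 ?add0r; last first.
    by move=> m /andP[m0 _]; rewrite /unit_raw /= (gtn_eqF m0) !andbF.
  rewrite normcN; case: k => [|k]; first by rewrite /= mul0r normc0 ltW.
  by rewrite /unit_raw /= mulr0 normc0 ltW.
Qed.

Definition unit_vec i : X := sn_mk (D := path_family weightX) (unit_mem i).

Lemma sum_unit_raw (s : seq nat) (alpha : nat -> R[i]) c : uniq s ->
  (\sum_(i <- s) alpha i *: unit_raw i) c =
  if [&& c.1.1.1, c.1.1.2 == 0%N, c.1.2 == 0%N & c.2 \in s] then alpha c.2 else 0.
Proof.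
move=> us; rewrite fct_sumE.
have [h|h] := boolP [&& c.1.1.1, c.1.1.2 == 0%N & c.1.2 == 0%N]; last first.
  rewrite big1 => [|i _].
    by case: ifP => // /and4P[h1 h2 h3 _]; rewrite h1 h2 h3 in h.
  rewrite -[LHS]/(alpha i * unit_raw i c) /unit_raw.
  by case: ifP => [/and4P[h1 h2 h3 _]|_]; [rewrite h1 h2 h3 in h|rewrite mulr0].
have uE i : (alpha i *: unit_raw i) c = if c.2 == i then alpha i else 0.
  rewrite -[LHS]/(alpha i * unit_raw i c) /unit_raw; case/and3P: h => -> -> -> /=.
  by case: ifP; rewrite ?mulr1 ?mulr0.
under eq_bigr do rewrite uE.
have -> : [&& c.1.1.1, c.1.1.2 == 0%N, c.1.2 == 0%N & c.2 \in s] = (c.2 \in s).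
  by case/and3P: h => -> -> ->.
have [cs|cs] := boolP (c.2 \in s).
  rewrite (bigD1_seq _ cs us) /= eqxx big1 ?addr0 // => i.
  by rewrite eq_sym => /negbTE ->.
rewrite big_seq big1 // => i iS; case: eqP => // ci.
by rewrite ci iS in cs.
Qed.

Lemma norm_sum_unit (s : seq nat) (alpha : nat -> R[i]) : uniq s ->
  sn_norm (\sum_(i <- s) alpha i *: unit_vec i : X) <= l2s s alpha.
Proof.
move=> us; apply: sn_norm_le => -[[b k] M].
have -> : val (\sum_(i <- s) alpha i *: unit_vec i : X) = \sum_(i <- s) alpha i *: unit_raw i.
  by rewrite raddf_sum.
have := fun c => sum_unit_raw alpha c us; move: (\sum_(i <- s) _) => w wE.
rewrite -[leLHS]/(cell_norm (b, k, M) w).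
have [->|M0] := posnP M; first by rewrite /cell_norm /pvar big_geq // l2s_ge0.
rewrite /cell_norm /pvar /= big_ltn // big_nat big1 ?addr0; last first.
  move=> m /andP[m0 _]; rewrite -(l2s0 (iota 0 M)); apply: eq_l2s => j _.
  by rewrite /cell wE /= (gtn_eqF m0) !andbF.
rewrite (l2s_le _ _ (l2s_ge0 _ _)) l2s_sqr.
apply: (@le_trans _ _ (\sum_(j <- [seq j <- iota 0 M | j \in s]) normc (alpha j) ^+ 2)).
  rewrite big_filter [leRHS]big_mkcond; apply: ler_sum => j _.
  rewrite /cell wE /=.
  case: (j \in s); case: b; case: (k == 0%N) => //=; rewrite ?normc0 ?expr0n ?sqr_ge0 //.
apply: ler_sum_subset => [j||j]; [exact: sqr_ge0|by rewrite filter_uniq ?iota_uniq|].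
by rewrite mem_filter; case/andP.
Qed.

End UnitVectors.

Lemma l2s_supp (R : realType) (a : nat -> R[i]) m L :
  (forall j, (m <= j)%N -> a j = 0) -> l2s (iota 0 L) a <= l2s (iota 0 m) a.
Proof.
move=> am; have [Lm|mL] := leqP L m; first exact: l2s_iota.
rewrite -[L](subnKC (ltnW mL)) iotaD l2s_cat.
have -> : l2s (iota (0 + m) (L - m)) a = 0.
  rewrite -(l2s0 (iota (0 + m) (L - m))); apply: eq_l2s => j.
  by rewrite mem_iota => /andP[mj _]; exact: am.
by rewrite /normc expr0n addr0 sqrtr_sqr ger0_norm ?l2s_ge0.
Qed.

(** * The Schur property applied to the images of the unit vectors *)

Section BoundedOperator.
Context {R : realType}.
Local Notation raw := (cell_index -> R[i]).
Local Notation X := (sn_space (path_family (@weightX R))).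
Local Notation Y := (sn_space (path_family (@weightY R))).

Variables (v : {linear X -> Y}) (C : R).
Hypotheses (C0 : 0 <= C) (vC : forall u, sn_norm (v u) <= C * sn_norm u).

Lemma norm_v_sum (s : seq nat) (alpha : nat -> R[i]) : uniq s ->
  sn_norm (\sum_(i <- s) alpha i *: v (unit_vec i) : Y) <= C * l2s s alpha.
Proof.
move=> us; have -> : \sum_(i <- s) alpha i *: v (unit_vec i) =
    v (\sum_(i <- s) alpha i *: unit_vec i).
  by rewrite linear_sum; apply: eq_bigr => i _; rewrite linearZ.
by apply: le_trans (vC _) _; rewrite ler_wpM2l // norm_sum_unit.
Qed.

(* Duality: test the functional on the combination of the v e_i whose coefficients
   are the conjugates of its values. *)
Lemma sum_functional (theta : raw -> R[i]) (s : seq nat) :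
  (forall x y, theta (x + y) = theta x + theta y) ->
  (forall c x, theta (c *: x) = c * theta x) ->
  (forall y : Y, normc (theta (val y)) <= sn_norm y) -> uniq s ->
  \sum_(i <- s) normc (theta (val (v (unit_vec i)))) ^+ 2 <= C ^+ 2.
Proof.
move=> thD thZ th1 us; pose alpha i := (theta (val (v (unit_vec i))))^*%C.
have nalpha i : normc (alpha i) = normc (theta (val (v (unit_vec i)))).
  by rewrite /alpha -[normc _]/(complex.Re (normc _)%:C%C) -normcE_norm normcJ normcE_norm.
under eq_bigr do rewrite -nalpha.
rewrite -l2s_sqr ler_pXn2r ?nnegrE ?l2s_ge0 //.
have th_sum : theta (val (\sum_(i <- s) alpha i *: v (unit_vec i) : Y)) =
    (l2s s alpha ^+ 2)%:C%C.
  rewrite l2s_sqr rmorph_sum; elim: (s) => [|i r IH].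
    by rewrite !big_nil raddf0 -(scale0r 0) thZ mul0r.
  rewrite !big_cons raddfD /= thD IH thZ; congr (_ + _).
  by rewrite [RHS]sqr_normcE /alpha conjcK.
have := le_trans (th1 _) (norm_v_sum alpha us).
rewrite th_sum normc_real ger0_norm ?sqr_ge0 // expr2.
have [->|l0] := eqVneq (l2s s alpha) 0; first by [].
by rewrite ler_pM2r // lt_def l0 l2s_ge0.
Qed.

(** A coordinate is a contractive functional, so by [sum_functional] its values on the images are
    square summable. *)
Lemma coord_cvg0 (c : cell_index) eps : 0 < eps ->
  exists i0, forall i, (i0 <= i)%N -> normc (val (v (unit_vec i)) c) <= eps.
Proof.
move=> e0; have [N NP] : exists N, forall L M, (N <= L)%N ->
    \sum_(L <= i < M) normc (val (v (unit_vec i)) c) ^+ 2 <= eps ^+ 2.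
  apply: (@tail_small _ _ (C ^+ 2)) => [j|M|]; [exact: sqr_ge0| |by rewrite exprn_gt0].
  rewrite /index_iota subn0; apply: (@sum_functional (fun x => x c)) => [//|//|y|]; last exact: iota_uniq.
  exact: normc_sn_norm.
exists N => i Ni; have := NP i i.+1 Ni; rewrite big_nat1.
by rewrite ler_pXn2r ?nnegrE ?normc_ge0 // ltW.
Qed.

Definition block (y : raw) k m : R := l2s (iota 0 m) (cell y true k m).

Lemma block_cvg0 k m eps : 0 < eps ->
  exists i0, forall i, (i0 <= i)%N -> block (val (v (unit_vec i))) k m <= eps.
Proof.
move=> e0; suff [i0 h] : exists i0, forall i, (i0 <= i)%N ->
    \sum_(j <- iota 0 m) normc (cell (val (v (unit_vec i))) true k m j) <= eps.
  by exists i0 => i /h; apply: le_trans; exact: l2s_le_sum.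
elim: (iota 0 m) eps e0 => [|j s IH] eps e0.
  by exists 0%N => i _; rewrite big_nil ltW.
have e2 : 0 < eps / 2 by rewrite divr_gt0.
have [i1 h1] := IH _ e2; have [i2 h2] := coord_cvg0 (true, k, m, j) e2.
exists (maxn i1 i2) => i; rewrite geq_max => /andP[/h1 k1 /h2 k2].
by rewrite big_cons (splitr eps) lerD.
Qed.

(** The variation of the path alone: the sum starts at m = 1, leaving out the vector y in block
    0. *)
Definition pathvar (y : raw) k M : R := \sum_(1 <= m < M) block y k m.

Lemma pathvar_le (y : Y) k M : pathvar (val y) k M <= sn_norm y.
Proof.
apply: le_trans (sn_le_norm y (true, k, M)).
rewrite -[leRHS]/(pvar M (cell (val y) true k)) /pvar.
have [->|M0] := posnP M; first by rewrite /pathvar !big_geq.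
rewrite [leRHS]big_ltn // ler_wpDl ?l2s_ge0 // /pathvar !big_nat.
by apply: ler_sum => m /andP[_ /ltnW mM]; exact: l2s_iota.
Qed.

Lemma pathvar_cvg0_fin k M eps : 0 < eps ->
  exists i0, forall i, (i0 <= i)%N -> pathvar (val (v (unit_vec i))) k M <= eps.
Proof.
rewrite /pathvar /index_iota; elim: (iota _ _) eps => [|m s IH] eps e0.
  by exists 0%N => i _; rewrite big_nil ltW.
have e2 : 0 < eps / 2 by rewrite divr_gt0.
have [i1 h1] := IH _ e2; have [i2 h2] := block_cvg0 k m e2.
exists (maxn i1 i2) => i; rewrite geq_max => /andP[/h1 k1 /h2 k2].
by rewrite big_cons (splitr eps) lerD.
Qed.

Lemma pathvar_mono y k M M' : (M <= M')%N -> pathvar y k M <= pathvar y k M'.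
Proof.
case: M => [|M] MM'; first by rewrite /pathvar big_geq // sumr_ge0 // => m _; exact: l2s_ge0.
rewrite /pathvar (big_cat_nat _ MM') //= lerDl sumr_ge0 // => m _; exact: l2s_ge0.
Qed.

(* Schur property: gliding hump in the l1-sum of the finite-dimensional blocks. *)
Lemma pathvar_cvg0 k delta : 0 < delta -> exists i0, forall i, (i0 <= i)%N ->
  forall M, pathvar (val (v (unit_vec i))) k M <= delta.
Proof.
move=> d0; apply: contrapT => nh.
have big_i i0 : exists i M, (i0 <= i)%N /\ delta < pathvar (val (v (unit_vec i))) k M.
  apply: contrapT => ni; apply: nh; exists i0 => i i0i M; rewrite leNgt.
  by apply/negP => dM; apply: ni; exists i, M.
pose w (s : seq nat) : Y := \sum_(i <- s) v (unit_vec i).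
have hump N : exists (s : seq nat) M, [/\ uniq s, size s = N &
    N%:R * (delta / 2) <= pathvar (val (w s)) k M].
  elim: N => [|N [s [M [us sN sM]]]].
    by exists [::], 1%N; split => //; rewrite mul0r /pathvar big_geq.
  (* Adding a vector loses [delta / 8] three times: its own variation up to [M1] is subtracted both
     from the old head and from its own total, and the tail of the old sum beyond [M1] once. The net
     gain, 5/8 of [delta], exceeds [delta / 2]. *)
  have d8 : 0 < delta / 8%:R by rewrite divr_gt0.
  have [N1 tl] : exists N1, forall L M, (N1 <= L)%N ->
      \sum_(L <= m < M) block (val (w s)) k m <= delta / 8%:R.
    apply: (@tail_small _ _ (l2s (iota 0 1) (cell (val (w s)) true k 0%N) + sn_norm (w s))) => //.
      by move=> m; exact: l2s_ge0.
    case=> [|M']; first by rewrite big_geq // addr_ge0 ?l2s_ge0 ?sn_norm_ge0.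
    rewrite big_ltn // lerD //; last exact: pathvar_le.
    by rewrite /block l2s_iota.
  pose M1 := (maxn (maxn M N1) 1).
  have [i1 h1] := pathvar_cvg0_fin k M1 d8.
  have [i [M2 [i1i dM2]]] := big_i (maxn i1 (\max_(j <- s) j).+1).
  move: i1i; rewrite geq_max => /andP[/h1 hi1 maxi].
  have is_new : i \notin s.
    apply/negP => iS; have := @leq_bigmax_seq _ s xpredT id i iS isT.
    by rewrite leqNgt maxi.
  exists (i :: s), (maxn M1 M2); split; rewrite /= ?is_new ?sN //.
  set M3 := maxn M1 M2.
  have M13 : (M1 <= M3)%N by exact: leq_maxl.
  have M1pos : (1 <= M1)%N by exact: leq_maxr.
  have split_var (y : raw) : pathvar y k M3 = pathvar y k M1 + \sum_(M1 <= m < M3) block y k m.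
    by rewrite /pathvar (big_cat_nat M1pos M13).
  have wE : val (w (i :: s)) = val (v (unit_vec i)) + val (w s).
    by rewrite /w big_cons raddfD.
  have block_ge y z m : block y k m <= block (y + z) k m + block z k m.
    have -> : block z k m = block (- z) k m by rewrite /block -l2sN.
    rewrite -{1}[y](addrK z); exact: l2sD.
  have head : pathvar (val (w s)) k M1 <=
      pathvar (val (w (i :: s))) k M1 + pathvar (val (v (unit_vec i))) k M1.
    rewrite wE /pathvar -big_split; apply: ler_sum => m _.
    by rewrite [val (v _) + _]addrC; exact: block_ge.
  have tlw : \sum_(M1 <= m < M3) block (val (v (unit_vec i))) k m <=
      \sum_(M1 <= m < M3) block (val (w (i :: s))) k m + \sum_(M1 <= m < M3) block (val (w s)) k m.
    by rewrite wE -big_split; apply: ler_sum => m _; exact: block_ge.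
  have sM1 : pathvar (val (w s)) k M <= pathvar (val (w s)) k M1.
    by apply: pathvar_mono; rewrite /M1 !leq_max leqnn.
  have tl1 : \sum_(M1 <= m < M3) block (val (w s)) k m <= delta / 8%:R.
    by apply: tl; rewrite /M1 !leq_max leqnn orbT.
  have dM3 : delta < pathvar (val (v (unit_vec i))) k M3.
    by apply: lt_le_trans dM2 _; apply: pathvar_mono; exact: leq_maxr.
  move: dM3; rewrite !split_var => dM3.
  by rewrite -natr1; lra.
(* A sum of N images has norm at most C sqrt N, but the hump gives variation at least N delta / 2;
   these are incompatible once N > (2 C / delta)^2. *)
pose N := (Num.truncn ((2 * C / delta) ^+ 2)).+1.
have Nbig : (2 * C / delta) ^+ 2 < N%:R.
  by have /andP[_] := truncn_itv (sqr_ge0 (2 * C / delta)).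
have [s [M [us sN sM]]] := hump N.
have wle : sn_norm (w s) <= C * Num.sqrt N%:R.
  have -> : w s = \sum_(i <- s) (1 : R[i]) *: v (unit_vec i).
    by apply: eq_bigr => i _; rewrite scale1r.
  apply: le_trans (norm_v_sum (fun=> 1) us) _; rewrite ler_wpM2l // /l2s.
  by rewrite big_const_seq count_predT sN normc1 expr1n iter_addr_0.
have := le_trans sM (le_trans (pathvar_le (w s) k M) wle).
have N0 : 0 < N%:R :> R by rewrite ltr0n.
have sq0 : 0 < Num.sqrt (N%:R : R) by rewrite sqrtr_gt0.
rewrite -{1}(sqr_sqrtr (ltW N0)) expr2 -mulrA [leRHS]mulrC ler_pM2l // => sC.
have sqN : Num.sqrt N%:R <= 2 * C / delta by rewrite ler_pdivlMr //; lra.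
have q0 : 0 <= 2 * C / delta by exact: le_trans (ltW sq0) sqN.
suff : Num.sqrt N%:R ^+ 2 <= (2 * C / delta) ^+ 2.
  by rewrite (sqr_sqrtr (ltW N0)) leNgt Nbig.
by rewrite ler_pXn2r ?nnegrE ?(ltW sq0).
Qed.

End BoundedOperator.

(** * Gliding hump over the cells and the test column *)

Section ColumnVector.
Context {R : realType}.
Local Notation raw := (cell_index -> R[i]).
Local Notation X := (sn_space (path_family (@weightX R))).
Local Notation Y := (sn_space (path_family (@weightY R))).

Lemma weightY_gt0 k : 0 < @weightY R k.
Proof. by rewrite /weightY invr_gt0. Qed.

(** The path starts at 0 and tends to [weightY k] times y, so the norm of this limit is at most the
    variation; positivity of the weight is essential. Convergence is only coordinatewise, hence the
    restriction to L coordinates with an error of eps / (L+1) in each. *)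
Lemma cell_vec_le_pathvar (y : Y) k L delta : (forall M, pathvar (val y) k M <= delta) ->
  l2s (iota 0 L) (cell_vec (val y) k) <= delta / weightY k.
Proof.
move=> yd; rewrite ler_pdivlMr ?weightY_gt0 // mulrC.
have [_ _ ys yl] := sn_memP y.
apply/ler_addgt0Pr => eps e0; have eL : 0 < eps / L.+1%:R by rewrite divr_gt0.
have [M MP] : exists M, forall j, (j < L)%N ->
    normc (\sum_(1 <= m < M) val y (true, k, m, j) -
      (weightY k)%:C%C * val y (true, k, 0%N, j)) <= eps / L.+1%:R.
  have /choice [N NP] j := yl k j _ eL.
  exists (\max_(j < L) N j) => j jL; apply: NP.
  exact: (@leq_bigmax _ (fun j : 'I_L => N j) (Ordinal jL)).
pose s j := \sum_(1 <= m < M) val y (true, k, m, j).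
have -> : weightY k * l2s (iota 0 L) (cell_vec (val y) k) =
    l2s (iota 0 L) ((weightY k)%:C%C *: cell_vec (val y) k).
  by rewrite l2sZ normc_real gtr0_norm ?weightY_gt0.
have -> : (weightY k)%:C%C *: cell_vec (val y) k =
    s - (s - (weightY k)%:C%C *: cell_vec (val y) k) by rewrite opprB addrC subrK.
apply: le_trans (l2sB _ _ _) _; rewrite lerD //.
  apply: le_trans (yd M).
  have -> : s = \sum_(1 <= m < M) cell (val y) true k m.
    by apply/funext => j; rewrite fct_sumE.
  apply: le_trans (l2s_sum _ _ _) _; rewrite /pathvar !big_nat.
  apply: ler_sum => m /andP[m1 _]; apply: l2s_supp => j mj.
  by apply: ys; rewrite m1.
apply: le_trans (l2s_le_sum _ _) _; rewrite big_seq.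
apply: (@le_trans _ _ (\sum_(j <- iota 0 L | j \in iota 0 L) eps / L.+1%:R)).
  by apply: ler_sum => j; rewrite mem_iota => jL; exact: MP.
rewrite -big_seq big_const_seq count_predT size_iota iter_addr_0.
by rewrite -[leLHS]mulr_natr mulrAC ler_pdivrMr ?ltr0n // ler_pM2l // ler_nat.
Qed.

Variables (v : {linear X -> Y}) (C : R).
Hypotheses (C0 : 0 <= C) (vC : forall u, sn_norm (v u) <= C * sn_norm u).

Let y i k : nat -> R[i] := cell_vec (val (v (unit_vec i))) k.

Lemma cell_vec_v_cvg0 k eps : 0 < eps -> exists i0, forall i, (i0 <= i)%N ->
  forall L, l2s (iota 0 L) (y i k) <= eps.
Proof.
move=> e0; have d0 : 0 < eps * weightY k by rewrite mulr_gt0 ?weightY_gt0.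
have [i0 h] := pathvar_cvg0 C0 vC k d0; exists i0 => i /h /cell_vec_le_pathvar.
by move=> H L; apply: le_trans (H L) _; rewrite mulfK // gt_eqF ?weightY_gt0.
Qed.

Lemma cell_vec_v_le i k L : l2s (iota 0 L) (y i k) <= C.
Proof.
apply: (@le_trans _ _ (sn_norm (v (unit_vec i)))).
  apply: le_trans (sn_le_norm (v (unit_vec i)) (true, k, L.+1)).
  apply: le_trans (l2s_iota _ (leqnSn L)) _.
  exact: (l2s_le_pvar (cell (val (v (unit_vec i))) true k) (ltn0Sn L)).
apply: le_trans (vC _) _; rewrite ler_piMr //; apply: sn_norm_le => -[[b k'] M].
by apply: le_trans (cell_norm_unit _ _ _ _) _; rewrite lern1 leq_b1.
Qed.

Lemma cell_vec_v_far (s : seq nat) eta : 0 < eta -> exists K, forall k, (K <= k)%N ->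
  forall L, \sum_(i <- s) l2s (iota 0 L) (y i k) ^+ 2 <= eta.
Proof.
elim: s eta => [|i s IH] eta e0; first by exists 0%N => k _ L; rewrite big_nil ltW.
have e2 : 0 < eta / 2 by rewrite divr_gt0.
have se2 : 0 < Num.sqrt (eta / 2) by rewrite sqrtr_gt0.
have [K1 h1] := IH _ e2; have [_ y0 _ _] := sn_memP (v (unit_vec i)).
have [K2 h2] := y0 _ se2; exists (maxn K1 K2) => k; rewrite geq_max => /andP[/h1 k1 k2] L.
rewrite big_cons (splitr eta) lerD // -(sqr_sqrtr (ltW e2)).
rewrite ler_pXn2r ?nnegrE ?l2s_ge0 ?sqrtr_ge0 //.
apply: le_trans (h2 true k L.+1 k2); apply: le_trans (l2s_iota _ (leqnSn L)) _.
exact: (l2s_le_pvar (cell (val (v (unit_vec i))) true k) (ltn0Sn L)).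
Qed.

(* Second gliding hump, over k: in each cell (true, k) at most one of the chosen
   vectors has a non-negligible l2-part. *)
Lemma column_hump n eta : 0 < eta -> exists s : seq nat, [/\ uniq s, size s = n &
  forall k L, \sum_(i <- s) l2s (iota 0 L) (y i k) ^+ 2 <= C ^+ 2 + n%:R * eta].
Proof.
move=> e0; elim: n => [|n [s [us sn sP]]].
  by exists [::]; split=> // k L; rewrite big_nil mul0r addr0 sqr_ge0.
(* From the cell K on, the vectors already chosen are negligible together; the next index is taken
   so large that its vector is negligible in the cells before K. So each cell pays C^2 at most once
   and [eta] otherwise. *)
have [K KP] := cell_vec_v_far s e0.
have se0 : 0 < Num.sqrt eta by rewrite sqrtr_gt0.
have [i0 i0P] : exists i0, forall k, (k < K)%N -> forall i, (i0 <= i)%N ->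
    forall L, l2s (iota 0 L) (y i k) <= Num.sqrt eta.
  have /choice [N NP] k := cell_vec_v_cvg0 k se0.
  exists (\max_(k < K) N k) => k kK i iN; apply: NP; apply: leq_trans iN.
  exact: (@leq_bigmax _ (fun k : 'I_K => N k) (Ordinal kK)).
pose i := maxn i0 (\max_(j <- s) j).+1.
have is_new : i \notin s.
  apply/negP => iS; have := @leq_bigmax_seq _ s xpredT id i iS isT.
  by rewrite leqNgt leq_maxr.
exists (i :: s); split; rewrite /= ?is_new ?sn // => k L; rewrite big_cons -natr1 mulrDl mul1r.
have [kK|Kk] := ltnP k K.
  rewrite addrC addrA lerD // -(sqr_sqrtr (ltW e0)) ler_pXn2r ?nnegrE ?l2s_ge0 ?sqrtr_ge0 //.
  by apply: i0P => //; exact: leq_maxl.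
rewrite lerD //; first by rewrite ler_pXn2r ?nnegrE ?l2s_ge0 // cell_vec_v_le.
by apply: le_trans (KP k Kk L) _; rewrite lerDr mulr_ge0 // ltW.
Qed.

Definition column_mx n (s : seq nat) (beta : R) : 'M[path_space (@weightX R)]_n.+1 :=
  \matrix_(a, b) (if b == ord0 then beta%:C%C *: unit_vec (nth 0%N s a) else 0 : X).

(** The tag [PathCol 0], tested on the first basis vector, sees in each row a single coordinate of
    modulus [beta]. *)
Lemma column_mx_ge n (s : seq nat) (beta : R) : 0 <= beta ->
  beta * Num.sqrt n.+1%:R <= mxnorm (column_mx n s beta).
Proof.
move=> b0; pose L := (\max_(i < n.+1) nth 0%N s i).+1.
have := @col_le_mxnorm _ _ (path_cols (@weightX R)) _ (column_mx n s beta) (PathCol 0) L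
  (fun b => (b == ord0)%:R).
have -> : \sum_(b < n.+1) normc ((b == ord0)%:R : R[i]) ^+ 2 = 1.
  rewrite (bigD1 ord0) // eqxx normc1 expr1n big1 => [|b /negbTE ->].
    exact: addr0.
  by rewrite normc0 expr0n.
rewrite mulr1 => H; rewrite -(@ler_pXn2r _ 2) ?nnegrE ?mulr_ge0 ?sqrtr_ge0 ?mxnorm_ge0 //.
apply: le_trans H; rewrite exprMn sqr_sqrtr // mulr_natr.
have -> : beta ^+ 2 *+ n.+1 = \sum_(a < n.+1) beta ^+ 2 by rewrite sumr_const card_ord.
apply: ler_sum => a _.
have aL : nth 0%N s a \in iota 0 L.
  by rewrite mem_iota add0n ltnS (@leq_bigmax _ (fun i : 'I_n.+1 => nth 0%N s i)).
rewrite (bigD1_seq _ aL (iota_uniq 0 L)) /= -[leLHS]addr0 lerD //; last first.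
  by apply: sumr_ge0 => i _; exact: sqr_ge0.
rewrite (bigD1 ord0) //= big1 ?addr0; last by move=> b /negbTE ->; rewrite mul0r.
rewrite /raw_mx mxE eqxx mul1r -[X in normc X]/(beta%:C%C * unit_raw (nth 0%N s a) (true, 0%N, 0%N, nth 0%N s a)).
by rewrite /unit_raw /= eqxx mulr1 normc_real real_normK ?num_real.
Qed.

(** For a matrix with one nonzero column, a tag contributes the square sum of its values on the
    entries. For the columns [PathCol] this is the bound provided by the hump; for the functionals
    [PathFun] it is the square summability in [sum_functional], with bound C. *)
Lemma column_mx_image_le n (s : seq nat) (beta B : R) : uniq s -> size s = n.+1 -> 0 <= B ->
  (forall k L, \sum_(i <- s) l2s (iota 0 L) (y i k) ^+ 2 <= B ^+ 2) -> C <= B ->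
  0 <= beta ->
  mxnorm (map_mx v (column_mx n s beta) : 'M[path_space (@weightY R)]_n.+1) <= beta * B.
Proof.
move=> us sn B0 sB CB b0; apply: mxnorm_le; first by rewrite mulr_ge0.
move=> t L xi.
have rawE a b i : path_cs t (raw_mx (map_mx v (column_mx n s beta) :
      'M[path_space (@weightY R)]_n.+1) a b) i =
    if b == ord0 then beta%:C%C * path_cs t (val (v (unit_vec (nth 0%N s a)))) i else 0.
  rewrite /raw_mx !mxE; case: ifP => _.
    by rewrite linearZ -path_csZ.
  by rewrite linear0 -[RHS](mul0r (path_cs t 0 i)) -path_csZ scale0r.
have row a i : normc (\sum_b xi b * path_cs t (raw_mx (map_mx v (column_mx n s beta) :
      'M[path_space (@weightY R)]_n.+1) a b) i) ^+ 2 =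
    normc (xi ord0) ^+ 2 * beta ^+ 2 * normc (path_cs t (val (v (unit_vec (nth 0%N s a)))) i) ^+ 2.
  rewrite (bigD1 ord0) //= rawE eqxx big1 ?addr0.
    by rewrite !normcM !exprMn normc_real real_normK ?num_real // mulrA.
  by move=> b /negbTE b1; rewrite rawE b1 mulr0.
rewrite [leLHS](_ : _ = normc (xi ord0) ^+ 2 * beta ^+ 2 *
    \sum_(i <- s) l2s (iota 0 L) (path_cs t (val (v (unit_vec i)))) ^+ 2); last first.
  rewrite (big_nth 0%N) sn big_mkord mulr_sumr; apply: eq_bigr => a _.
  by rewrite l2s_sqr mulr_sumr; apply: eq_bigr => i _; exact: row.
rewrite exprMn [leRHS]mulrC [leRHS]mulrA; apply: ler_pM.
- by rewrite mulr_ge0 ?sqr_ge0.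
- by apply: sumr_ge0 => i _; exact: sqr_ge0.
- rewrite ler_wpM2r ?sqr_ge0 // (bigD1 ord0) //= lerDl.
  by apply: sumr_ge0 => b _; exact: sqr_ge0.
case: t {rawE row} => [k|c k M g]; first exact: sB.
apply: (@le_trans _ _ (C ^+ 2)); last by rewrite ler_pXn2r ?nnegrE.
have th1 (z : Y) : normc (path_fun c k M g (val z)) <= sn_norm z.
  apply: le_trans (normc_path_fun c k M g (val z)) _.
  exact: (sn_le_norm z (c, k, M)).
have := sum_functional C0 vC (@path_funD _ c k M g) (@path_funZ _ c k M g) th1 us.
apply: le_trans.
apply: ler_sum => i _; rewrite ler_pXn2r ?nnegrE ?l2s_ge0 ?normc_ge0 //.
exact: (l2s_single 0%N _ (iota_uniq 0 L)).
Qed.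

End ColumnVector.

Lemma ereal_sup_lt_pinfty (R : realType) (S : set (\bar R)) : (ereal_sup S < +oo)%E ->
  exists2 C : R, 0 <= C & forall s, S s -> (s <= C%:E)%E.
Proof.
move=> Soo; have [C0 CS] : exists C : R, (ereal_sup S <= C%:E)%E.
  case: (ereal_sup S) Soo => [r _| |_] //; first by exists r.
  by exists 0; exact: leNye.
exists (Num.max C0 0); first by rewrite le_max lexx orbT.
move=> s Ss; apply: le_trans (ereal_sup_ubound Ss) _; apply: le_trans CS _.
by rewrite lee_fin le_max lexx.
Qed.

Lemma sn_normZ_real (R : realType) (D : seminormFamily R) (c : R) (u : sn_space D) :
  sn_norm (c%:C%C *: u) = `|c| * sn_norm u.
Proof.
by have := sn_normZ c%:C%C u; rewrite normcE_norm normc_real -rmorphM => /complexI.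
Qed.

(** Placing a vector in the corner (0, 0) of a zero matrix does not increase its norm, and an entry
    of a matrix is bounded by the matrix norm; so the amplification controls the map itself. *)
Lemma opnorm_entry (R : realType) (D D' : seminormFamily R) (W : columnSystem D)
    (W' : columnSystem D') (v : {linear sn_space D -> sn_space D'}) n (C : R) :
  (@opnorm R 'M[col_space W]_n.+1 'M[col_space W']_n.+1 mxnorm mxnorm (map_mx v) <= C%:E)%E ->
  forall u, sn_norm (v u) <= C * sn_norm u.
Proof.
move=> vC; have unit_le u : sn_norm u <= 1 -> sn_norm (v u) <= C.
  move=> u1; pose x : 'M[col_space W]_n.+1 :=
    \matrix_(a, b) (if (a == ord0) && (b == ord0) then u else 0 : sn_space D).
  have x1 : mxnorm x <= 1.
    apply: le_trans u1; apply: mxnorm_le; first exact: sn_norm_ge0.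
    apply: eq_col_le (@col_le_single _ _ W _ u ord0 ord0) => a b.
    by rewrite /raw_mx mxE; case: ifP => // _; rewrite raddf0.
  have := vnorm_entry (map_mx v x : 'M[col_space W']_n.+1) ord0 ord0.
  rewrite !mxE eqxx vnorm_sn => /le_trans; apply.
  by rewrite -lee_fin; apply: le_trans vC; apply: ereal_sup_ubound; exists x.
move=> u; have [u0|u0] := eqVneq (sn_norm u) 0.
  have -> : u = 0 by apply: sn_norm0_eq0; rewrite u0.
  by rewrite linear0 -!vnorm_sn !vnorm0 mulr0.
have up : 0 < sn_norm u by rewrite lt_def u0 sn_norm_ge0.
have := unit_le ((sn_norm u)^-1%:C%C *: u).
rewrite linearZ /= !sn_normZ_real ger0_norm ?invr_ge0 ?sn_norm_ge0 // mulVf //.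
by move=> /(_ (lexx _)); rewrite mulrC ler_pdivrMr.
Qed.

Lemma not_almost_completely_embeds (R : realType) :
  ~ almost_completely_isomorphically_embeds (path_space (@weightX R)) (path_space weightY).
Proof.
move=> [f [_ /ereal_sup_lt_pinfty [C C0 fC] /ereal_sup_lt_pinfty [D D0 fD]]].
(* The bound C^2 + (n+1) eta of the hump for n+1 vectors, with eta = 1 / (n+1): it does not grow
   with n. *)
pose B2 := C ^+ 2 + 1; pose B := Num.sqrt B2.
have B2p : 0 < B2 by rewrite ltr_wpDl ?sqr_ge0.
have Bp : 0 < B by rewrite sqrtr_gt0.
have BB : B ^+ 2 = B2 by rewrite sqr_sqrtr // ltW.
(* The column scaled by 1/B has image of norm at most 1, hence norm at most [D], while it is at
   least sqrt(n+1) / B. As [C] and [D] are uniform over the sequence of maps, n may be chosen after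
   them, before the map [f n.+1] is fixed. *)
pose n := Num.truncn ((D * B) ^+ 2).
have nbig : (D * B) ^+ 2 < n.+1%:R by have /andP[_] := truncn_itv (sqr_ge0 (D * B)).
pose v : {linear sn_space (path_family (@weightX R)) -> sn_space (path_family weightY)} :=
  f n.+1.
have vC u : sn_norm (v u) <= C * sn_norm u.
  by apply: (@opnorm_entry _ _ _ (path_cols _) (path_cols _) v n); apply: fC; exists n.+1.
have e0 : 0 < n.+1%:R^-1 :> R by rewrite invr_gt0.
have [s [us sn sP]] := column_hump C0 vC n.+1 e0.
pose x := column_mx n s B^-1.
have Bi0 : 0 <= B^-1 by rewrite invr_ge0 ltW.
have fx1 : mxnorm (map_mx v x : 'M[path_space (@weightY R)]_n.+1) <= 1.
  rewrite -(mulVf (lt0r_neq0 Bp)); apply: (column_mx_image_le C0 vC) => //.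
  - exact: ltW.
  - by move=> k L; apply: le_trans (sP k L) _; rewrite BB mulfV ?pnatr_eq0.
  - by rewrite -(@ler_pXn2r _ 2) ?nnegrE ?(ltW Bp) // BB lerDl.
have xD : mxnorm x <= D.
  rewrite -lee_fin; apply: le_trans (fD _ _); last by exists n.+1.
  by apply: ereal_sup_ubound; exists x.
have := le_trans (column_mx_ge n s Bi0) xD; rewrite mulrC ler_pdivrMr // => nD.
suff : n.+1%:R <= (D * B) ^+ 2 by rewrite leNgt nbig.
rewrite -[n.+1%:R]sqr_sqrtr // ler_pXn2r ?nnegrE ?sqrtr_ge0 //.
by rewrite mulr_ge0 // ltW.
Qed.

Theorem theorem1p4 (R : realType) :
  exists X Y : operatorSpace R,
    [/\ separable X, separable Y,
        isomorphically_embeds X Y,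
        ~ almost_completely_isomorphically_embeds X Y
      & bounded_subsets_almost_completely_coarsely_equivalent X Y].
Proof.
exists (path_space weightX), (path_space weightY); split.
- exact: separable_path_space.
- exact: separable_path_space.
- exact: isomorphically_embeds_path_space.
- exact: not_almost_completely_embeds.
- exact: coarsely_equivalent_path_space.
Qed.
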